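(* There is a Turing ideal $\mathcal{I} \subseteq \mathcal{P}(\omega)$ such that the $\omega$-model $(\omega,\mathcal{I})$ satisfies $\mathsf{EM}$ but not $\mathsf{SRT}^2_2$. Therefore, $\mathsf{EM}$ does not imply $\mathsf{SRT}^2_2$ (over $\mathsf{RCA}_0$).
   Context: A Turing ideal is a nonempty collection of subsets of $\omega$ closed under Turing reducibility and join; $(\omega,\mathcal{I})$ is the $\omega$-model of second order arithmetic with second order part $\mathcal{I}$ (a model of $\mathsf{RCA}_0$). A tournament on $D\subseteq\mathbb{N}$ is an irreflexive binary relation $T$ on $D$ such that for all $x\neq y$ in $D$ exactly one of $T(x,y)$, $T(y,x)$ holds. It is transitive if $T(x,y)$ and $T(y,z)$ imply $T(x,z)$. An infinite tournament is a tournament with domain $\mathbb{N}$; an infinite transitive subtournament of $T$ is an infinite $S\subseteq\mathbb{N}$ such that $T$ restricted to $S$ is transitive. $\mathsf{EM}$: every infinite tournament contains an infinite transitive subtournament. A 2-coloring is a function $c:[\mathbb{N}]^2\to\{0,1\}$, with $c(x,y)$ written for $c(\{x,y\})$. It is stable if for every $n$ there is $i\in\{0,1\}$ such that $c(n,y)=i$ for all but finitely many $y$. $H$ is homogeneous for $c$ if $c$ is constant on $[H]^2$. $\mathsf{SRT}^2_2$: every stable 2-coloring of $[\mathbb{N}]^2$ has an infinite homogeneous set. *)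

(* Defs.v *)
From Stdlib Require Import Arith Lia List Cantor Classical ClassicalDescription.
Import ListNotations.

(** Codes of unary oracle functionals on [nat]; tuples are passed through the
    Cantor pairing function. *)
Inductive code : Type :=
| Czero | Csucc | Cfst | Csnd | Coracle
| Cpair (f g : code)
| Ccomp (f g : code)
| Cprec (f g : code)
| Cmin (f : code).

Definition cpair (x y : nat) : nat := Cantor.to_nat (x, y).

(** [eval A c x y]: the program [c] with oracle (the characteristic function
    of) [A] halts on input [x] with output [y]. *)
Inductive eval (A : nat -> Prop) : code -> nat -> nat -> Prop :=
| eval_zero x : eval A Czero x 0
| eval_succ x : eval A Csucc x (S x)
| eval_fst x y : eval A Cfst (cpair x y) x
| eval_snd x y : eval A Csnd (cpair x y) y
| eval_oracle1 x : A x -> eval A Coracle x 1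
| eval_oracle0 x : ~ A x -> eval A Coracle x 0
| eval_pair f g x y z :
    eval A f x y -> eval A g x z -> eval A (Cpair f g) x (cpair y z)
| eval_comp f g x y z :
    eval A g x y -> eval A f y z -> eval A (Ccomp f g) x z
| eval_prec0 f g a y :
    eval A f a y -> eval A (Cprec f g) (cpair a 0) y
| eval_precS f g a n y z :
    eval A (Cprec f g) (cpair a n) y ->
    eval A g (cpair a (cpair n y)) z ->
    eval A (Cprec f g) (cpair a (S n)) z
| eval_min f a m (v : nat -> nat) :
    (forall k, k < m -> eval A f (cpair a k) (S (v k))) ->
    eval A f (cpair a m) 0 ->
    eval A (Cmin f) a m.

Definition turing_le (X Y : nat -> Prop) : Prop :=
  exists c, forall n, (X n -> eval Y c n 1) /\ (~ X n -> eval Y c n 0).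

Definition turing_join (X Y : nat -> Prop) (n : nat) : Prop :=
  exists k, (n = 2 * k /\ X k) \/ (n = 2 * k + 1 /\ Y k).

Definition turing_ideal (I : (nat -> Prop) -> Prop) : Prop :=
  (exists X, I X) /\
  (forall X Y, I Y -> turing_le X Y -> I X) /\
  (forall X Y, I X -> I Y -> I (turing_join X Y)).

(** Number variables and set variables are two independent families of
    de Bruijn indices: a number quantifier binds number index 0 and leaves the
    set indices alone, and conversely. *)
Inductive term : Type :=
| Var (k : nat) | Zero | One
| Plus (s t : term) | Mult (s t : term).

Inductive form : Type :=
| Eq (s t : term) | Lt (s t : term) | Mem (t : term) (X : nat)
| Bot
| Imp (p q : form) | And (p q : form) | Or (p q : form)
| AllN (p : form) | ExN (p : form)
| AllS (p : form) | ExS (p : form).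

Declare Scope so_scope.
Delimit Scope so_scope with so.
Bind Scope so_scope with form.
Infix "≐" := Eq (at level 70) : so_scope.
Infix "≺" := Lt (at level 70) : so_scope.
Infix "∊" := Mem (at level 70) : so_scope.
Infix "⋏" := And (at level 80, right associativity) : so_scope.
Infix "⋎" := Or (at level 85, right associativity) : so_scope.
Infix "⟹" := Imp (at level 90, right associativity) : so_scope.
Open Scope so_scope.

Definition Neg (p : form) : form := p ⟹ Bot.
Definition Iff (p q : form) : form := (p ⟹ q) ⋏ (q ⟹ p).

Definition scons {A : Type} (a : A) (s : nat -> A) (k : nat) : A :=
  match k with 0 => a | S k => s k end.

Fixpoint tsubst (s : nat -> term) (t : term) : term :=
  match t with
  | Var k => s k
  | Zero => Zero
  | One => One
  | Plus a b => Plus (tsubst s a) (tsubst s b)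
  | Mult a b => Mult (tsubst s a) (tsubst s b)
  end.

Definition tshift : term -> term := tsubst (fun k => Var (S k)).

Fixpoint nsubst (s : nat -> term) (p : form) : form :=
  match p with
  | Eq a b => Eq (tsubst s a) (tsubst s b)
  | Lt a b => Lt (tsubst s a) (tsubst s b)
  | Mem a X => Mem (tsubst s a) X
  | Bot => Bot
  | Imp p q => Imp (nsubst s p) (nsubst s q)
  | And p q => And (nsubst s p) (nsubst s q)
  | Or p q => Or (nsubst s p) (nsubst s q)
  | AllN p => AllN (nsubst (scons (Var 0) (fun k => tshift (s k))) p)
  | ExN p => ExN (nsubst (scons (Var 0) (fun k => tshift (s k))) p)
  | AllS p => AllS (nsubst s p)
  | ExS p => ExS (nsubst s p)
  end.

(** Renaming of set variables (set terms are just set variables). *)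
Fixpoint srename (r : nat -> nat) (p : form) : form :=
  match p with
  | Eq a b => Eq a b
  | Lt a b => Lt a b
  | Mem a X => Mem a (r X)
  | Bot => Bot
  | Imp p q => Imp (srename r p) (srename r q)
  | And p q => And (srename r p) (srename r q)
  | Or p q => Or (srename r p) (srename r q)
  | AllN p => AllN (srename r p)
  | ExN p => ExN (srename r p)
  | AllS p => AllS (srename (scons 0 (fun k => S (r k))) p)
  | ExS p => ExS (srename (scons 0 (fun k => S (r k))) p)
  end.

Definition ninst (t : term) : form -> form := nsubst (scons t Var).
Definition nshift : form -> form := nsubst (fun k => Var (S k)).
Definition sinst (X : nat) : form -> form := srename (scons X (fun k => k)).
Definition sshift : form -> form := srename S.

(** Classical two-sorted natural deduction with equality on numbers.
    [proves T G p]: [p] is derivable from the axioms [T] and the open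
    hypotheses [G].  The members of [T] are read as their universal closures,
    so the eigenvariable conditions concern [G] only. *)
Inductive proves (T : form -> Prop) : list form -> form -> Prop :=
| pr_ax G p : T p -> proves T G p
| pr_hyp G p : In p G -> proves T G p
| pr_raa G p : proves T (Neg p :: G) Bot -> proves T G p
| pr_impI G p q : proves T (p :: G) q -> proves T G (p ⟹ q)
| pr_impE G p q : proves T G (p ⟹ q) -> proves T G p -> proves T G q
| pr_andI G p q : proves T G p -> proves T G q -> proves T G (p ⋏ q)
| pr_andE1 G p q : proves T G (p ⋏ q) -> proves T G p
| pr_andE2 G p q : proves T G (p ⋏ q) -> proves T G q
| pr_orI1 G p q : proves T G p -> proves T G (p ⋎ q)
| pr_orI2 G p q : proves T G q -> proves T G (p ⋎ q)
| pr_orE G p q r :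
    proves T G (p ⋎ q) -> proves T (p :: G) r -> proves T (q :: G) r ->
    proves T G r
| pr_allNI G p : proves T (map nshift G) p -> proves T G (AllN p)
| pr_allNE G p t : proves T G (AllN p) -> proves T G (ninst t p)
| pr_exNI G p t : proves T G (ninst t p) -> proves T G (ExN p)
| pr_exNE G p q :
    proves T G (ExN p) -> proves T (p :: map nshift G) (nshift q) ->
    proves T G q
| pr_allSI G p : proves T (map sshift G) p -> proves T G (AllS p)
| pr_allSE G p X : proves T G (AllS p) -> proves T G (sinst X p)
| pr_exSI G p X : proves T G (sinst X p) -> proves T G (ExS p)
| pr_exSE G p q :
    proves T G (ExS p) -> proves T (p :: map sshift G) (sshift q) ->
    proves T G q
| pr_eq_refl G t : proves T G (t ≐ t)
| pr_eq_subst G p s t :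
    proves T G (s ≐ t) -> proves T G (ninst s p) -> proves T G (ninst t p).

Inductive Delta00 : form -> Prop :=
| d_eq s t : Delta00 (s ≐ t)
| d_lt s t : Delta00 (s ≺ t)
| d_mem t X : Delta00 (t ∊ X)
| d_bot : Delta00 Bot
| d_imp p q : Delta00 p -> Delta00 q -> Delta00 (p ⟹ q)
| d_and p q : Delta00 p -> Delta00 q -> Delta00 (p ⋏ q)
| d_or p q : Delta00 p -> Delta00 q -> Delta00 (p ⋎ q)
| d_all t p : Delta00 p -> Delta00 (AllN (Var 0 ≺ tshift t ⟹ p))
| d_ex t p : Delta00 p -> Delta00 (ExN (Var 0 ≺ tshift t ⋏ p)).

Definition Sigma01 (p : form) : Prop := exists q, Delta00 q /\ p = ExN q.
Definition Pi01 (p : form) : Prop := exists q, Delta00 q /\ p = AllN q.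

(** The formula [p(n+1)], for a formula [p(n)] with [n] at number index 0. *)
Definition nsucc : form -> form :=
  nsubst (scons (Plus (Var 0) One) (fun k => Var (S k))).

(** Free variables are parameters; see [proves].  In [rca_comp] the set
    quantifier binds set index 0, and [sshift] expresses that the new set does
    not occur in [p]. *)
Inductive RCA0 : form -> Prop :=
| rca_succ_nonzero : RCA0 (Neg (Plus (Var 0) One ≐ Zero))
| rca_succ_inj :
    RCA0 (Plus (Var 0) One ≐ Plus (Var 1) One ⟹ Var 0 ≐ Var 1)
| rca_plus0 : RCA0 (Plus (Var 0) Zero ≐ Var 0)
| rca_plusS :
    RCA0 (Plus (Var 0) (Plus (Var 1) One) ≐ Plus (Plus (Var 0) (Var 1)) One)
| rca_mult0 : RCA0 (Mult (Var 0) Zero ≐ Zero)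
| rca_multS :
    RCA0 (Mult (Var 0) (Plus (Var 1) One)
          ≐ Plus (Mult (Var 0) (Var 1)) (Var 0))
| rca_lt0 : RCA0 (Neg (Var 0 ≺ Zero))
| rca_ltS :
    RCA0 (Iff (Var 0 ≺ Plus (Var 1) One) (Var 0 ≺ Var 1 ⋎ Var 0 ≐ Var 1))
| rca_ind p :
    Sigma01 p ->
    RCA0 (ninst Zero p ⋏ AllN (p ⟹ nsucc p) ⟹ AllN p)
| rca_comp p q :
    Sigma01 p -> Pi01 q ->
    RCA0 (AllN (Iff p q) ⟹ ExS (AllN (Iff (Var 0 ∊ 0) (sshift p)))).

(** Simpson's pairing term [(s, t) = (s + t)^2 + s], injective on pairs. *)
Definition Pair (s t : term) : term :=
  Plus (Mult (Plus s t) (Plus s t)) s.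

Definition Infinite (S : nat) : form :=
  AllN (ExN (Var 1 ≺ Var 0 ⋏ Var 0 ∊ S)).

Definition Tournament (T : nat) : form :=
  AllN (Var 0 ∊ T ⟹ ExN (ExN (Var 2 ≐ Pair (Var 1) (Var 0)))) ⋏
  AllN (Neg (Pair (Var 0) (Var 0) ∊ T)) ⋏
  AllN (AllN (Neg (Var 1 ≐ Var 0) ⟹
    ((Pair (Var 1) (Var 0) ∊ T ⋏ Neg (Pair (Var 0) (Var 1) ∊ T)) ⋎
     (Neg (Pair (Var 1) (Var 0) ∊ T) ⋏ Pair (Var 0) (Var 1) ∊ T)))).

Definition Transitive_on (T S : nat) : form :=
  AllN (AllN (AllN
    (Var 2 ∊ S ⋏ Var 1 ∊ S ⋏ Var 0 ∊ S ⋏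
     Pair (Var 2) (Var 1) ∊ T ⋏ Pair (Var 1) (Var 0) ∊ T ⟹
     Pair (Var 2) (Var 0) ∊ T))).

Definition EM : form :=
  AllS (Tournament 0 ⟹ ExS (Infinite 0 ⋏ Transitive_on 1 0)).

(** The set [C] is (the graph of) a function from [N]^2 to {0,1}, where the
    unordered pair {x,y} with x < y is coded by [Pair x y]. *)
Definition Coloring (C : nat) : form :=
  AllN (Var 0 ∊ C ⟹ ExN (ExN (ExN
    (Var 2 ≺ Var 1 ⋏ (Var 0 ≐ Zero ⋎ Var 0 ≐ One) ⋏
     Var 3 ≐ Pair (Pair (Var 2) (Var 1)) (Var 0))))) ⋏
  AllN (AllN (Var 1 ≺ Var 0 ⟹
    ((Pair (Pair (Var 1) (Var 0)) Zero ∊ C ⋏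
      Neg (Pair (Pair (Var 1) (Var 0)) One ∊ C)) ⋎
     (Neg (Pair (Pair (Var 1) (Var 0)) Zero ∊ C) ⋏
      Pair (Pair (Var 1) (Var 0)) One ∊ C)))).

(** [c(s,t) = i], i.e. c({s,t}) = i, where [C] is the graph of c. *)
Definition Color (C : nat) (s t i : term) : form :=
  (s ≺ t ⋏ Pair (Pair s t) i ∊ C) ⋎ (t ≺ s ⋏ Pair (Pair t s) i ∊ C).

Definition Stable (C : nat) : form :=
  AllN (ExN ((Var 0 ≐ Zero ⋎ Var 0 ≐ One) ⋏
    ExN (AllN (Var 1 ≺ Var 0 ⟹ Color C (Var 3) (Var 0) (Var 2))))).

Definition Homogeneous (C H : nat) : form :=
  ExN ((Var 0 ≐ Zero ⋎ Var 0 ≐ One) ⋏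
    AllN (AllN (Var 1 ∊ H ⋏ Var 0 ∊ H ⋏ Neg (Var 1 ≐ Var 0) ⟹
      Color C (Var 1) (Var 0) (Var 2)))).

Definition SRT22 : form :=
  AllS (Coloring 0 ⋏ Stable 0 ⟹ ExS (Infinite 0 ⋏ Homogeneous 1 0)).

Fixpoint teval (e : nat -> nat) (t : term) : nat :=
  match t with
  | Var k => e k
  | Zero => 0
  | One => 1
  | Plus a b => teval e a + teval e b
  | Mult a b => teval e a * teval e b
  end.

Fixpoint sat (I : (nat -> Prop) -> Prop)
    (e : nat -> nat) (E : nat -> nat -> Prop) (p : form) : Prop :=
  match p with
  | Eq a b => teval e a = teval e b
  | Lt a b => teval e a < teval e b
  | Mem a X => E X (teval e a)
  | Bot => False
  | Imp p q => sat I e E p -> sat I e E q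
  | And p q => sat I e E p /\ sat I e E q
  | Or p q => sat I e E p \/ sat I e E q
  | AllN p => forall n, sat I (scons n e) E p
  | ExN p => exists n, sat I (scons n e) E p
  | AllS p => forall X, I X -> sat I e (scons X E) p
  | ExS p => exists X, I X /\ sat I e (scons X E) p
  end.

Definition omega_models (I : (nat -> Prop) -> Prop) (p : form) : Prop :=
  forall e E, (forall k, I (E k)) -> sat I e E p.

Definition npair (x y : nat) : nat := (x + y) * (x + y) + x.

Lemma npair_inj x y x' y' :
  npair x y = npair x' y' -> x = x' /\ y = y'.
Proof.
  unfold npair; intros H.
  assert (x + y = x' + y') by
    (destruct (lt_eq_lt_dec (x + y) (x' + y')) as [[]|]; nia).
  nia.
Qed.

Lemma omega_models_EM I (hI : exists X, I X) :
  omega_models I EM <->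
  forall T, I T ->
    (forall z, T z -> exists x y, z = npair x y) ->
    (forall x, ~ T (npair x x)) ->
    (forall x y, x <> y ->
       (T (npair x y) /\ ~ T (npair y x)) \/
       (~ T (npair x y) /\ T (npair y x))) ->
    exists S, I S /\
      (forall m, exists n, m < n /\ S n) /\
      (forall x y z, S x -> S y -> S z ->
         T (npair x y) -> T (npair y z) -> T (npair x z)).
Proof.
  split.
  - intros H T hT h1 h2 h3; destruct hI as [X0 hX0].
    destruct (H (fun _ => 0) (fun _ => X0) (fun _ => hX0) T hT
                (conj h1 (conj h2 h3))) as (S & hS & i & t).
    exists S; split; [exact hS | split; [exact i |]].
    intros x y z hx hy hz a b.
    exact (t x y z (conj hx (conj hy (conj hz (conj a b))))).
  - intros H e E hE T hT (h1 & h2 & h3).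
    destruct (H T hT h1 h2 h3) as (S & hS & i & t).
    exists S; split; [exact hS | split; [exact i |]].
    intros x y z (hx & hy & hz & a & b).
    exact (t x y z hx hy hz a b).
Qed.

Definition color_graph (c : nat -> nat -> bool) (C : nat -> Prop) : Prop :=
  forall z, C z <-> exists x y, x < y /\
    z = npair (npair x y) (if c x y then 1 else 0).

Lemma omega_models_SRT22 I (hI : exists X, I X) :
  omega_models I SRT22 <->
  forall c : nat -> nat -> bool,
    (forall x y, c x y = c y x) ->
    (exists C, I C /\ color_graph c C) ->
    (forall n, exists i m, forall y, m < y -> c n y = i) ->
    exists H, I H /\
      (forall m, exists n, m < n /\ H n) /\
      (exists i, forall x y, H x -> H y -> x <> y -> c x y = i).
Proof.
  assert (key : forall c C, (forall x y, c x y = c y x) -> color_graph c C ->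
    forall x y (i : bool), x <> y ->
     ((x < y /\ C (npair (npair x y) (if i then 1 else 0))) \/
      (y < x /\ C (npair (npair y x) (if i then 1 else 0)))) <->
     c x y = i).
  { intros c C sym hc x y i hxy; split.
    - intros [[hlt h]|[hlt h]]; apply hc in h;
        destruct h as (x' & y' & _ & h);
        apply npair_inj in h; destruct h as [h hi];
        apply npair_inj in h; destruct h as [<- <-];
        [| rewrite sym]; destruct i, (c _ _); congruence.
    - intros <-; destruct (proj1 (Nat.lt_gt_cases x y) hxy) as [h|h];
        [left|right]; (split; [exact h|]); apply hc;
        [exists x, y | exists y, x]; rewrite ?(sym y x); auto. }
  split.
  - intros Hs c sym (C & hC & hc) st; destruct hI as [X0 hX0].
    assert (col : forall x y, x < y -> forall i : bool,
      C (npair (npair x y) (if i then 1 else 0)) <-> c x y = i).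
    { intros x y hlt i.
      destruct (key c C sym hc x y i ltac:(lia)) as [k1 k2].
      split; [intros h; apply k1; auto|].
      intros h; destruct (k2 h) as [[_ g]|[g _]];
        [exact g | lia]. }
    destruct (Hs (fun _ => 0) (fun _ => X0) (fun _ => hX0) C hC)
      as (H & hH & inf & i & hi & hom).
    + split; [split|].
      * intros z hz; apply hc in hz; destruct hz as (x & y & h & ez).
        exists x, y, (if c x y then 1 else 0).
        split; [exact h | split; [| exact ez]].
        destruct (c x y); [right|left]; reflexivity.
      * intros x y hlt; cbn in hlt.
        pose proof (col x y hlt true) as ct.
        pose proof (col x y hlt false) as cf.
        destruct (c x y) eqn:hcxy; [right|left]; split.
        -- intros h; apply cf in h; discriminate.
        -- apply ct; reflexivity.
        -- apply cf; reflexivity.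
        -- intros h; apply ct in h; discriminate.
      * intros n; destruct (st n) as (i & m & h).
        exists (if i then 1 else 0).
        split; [destruct i; [right|left]; reflexivity|].
        exists (m + n); intros y hy; cbn in hy.
        apply (key c C sym hc n y i); [lia|].
        apply h; lia.
    + exists H; split; [exact hH | split; [exact inf|]].
      assert (exists b : bool, i = if b then 1 else 0) as [b ->]
        by (destruct hi as [hi|hi]; [exists false|exists true]; exact hi).
      exists b; intros x y hx hy hne.
      apply (key c C sym hc x y b hne).
      exact (hom x y (conj hx (conj hy hne))).
  - intros Hs e E hE C hC [[hg htot] st].
    pose (c := fun x y => if excluded_middle_informative
       (C (npair (npair (min x y) (max x y)) 1)) then true else false).
    assert (sym : forall x y, c x y = c y x).
    { intros x y; unfold c; rewrite Nat.min_comm, Nat.max_comm; reflexivity. }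
    assert (hc : color_graph c C).
    { intros z; split.
      - intros hz; destruct (hg z hz) as (x & y & i & hlt & hi & ez).
        cbn in hlt, hi, ez; fold (npair x y) in ez;
        fold (npair (npair x y) i) in ez; subst z.
        exists x, y; split; [exact hlt|]; f_equal.
        unfold c; rewrite Nat.min_l, Nat.max_r by lia.
        pose proof (htot x y hlt) as ht; cbn in ht.
        destruct (excluded_middle_informative _) as [h|h];
          destruct hi as [-> | ->]; try reflexivity; exfalso.
        + destruct ht as [[_ n]|[n _]]; [exact (n h)|exact (n hz)].
        + exact (h hz).
      - intros (x & y & hlt & ->).
        unfold c; rewrite Nat.min_l, Nat.max_r by lia.
        pose proof (htot x y hlt) as ht; cbn in ht.
        destruct (excluded_middle_informative _) as [h|h]; [exact h|].
        destruct ht as [[a _]|[_ a]]; [exact a | destruct (h a)]. }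
    destruct (Hs c sym) as (H & hH & inf & b & hom).
    + exists C; split; [exact hC | exact hc].
    + intros n; destruct (st n) as (i & hi & m & h).
      assert (exists b : bool, i = if b then 1 else 0) as [b ->]
        by (destruct hi as [hi|hi]; [exists false|exists true]; exact hi).
      exists b, (m + n); intros y hy.
      apply (key c C sym hc n y b); [lia|].
      apply h; cbn; lia.
    + exists H; split; [exact hH | split; [exact inf|]].
      exists (if b then 1 else 0).
      split; [destruct b; [right|left]; reflexivity|].
      intros x y (hx & hy & hne).
      apply (key c C sym hc x y b hne).
      exact (hom x y hx hy hne).
Qed.

(* Main.v *)
From Stdlib Require Import Arith Lia List Cantor Classical ClassicalEpsilon.
From Stdlib Require Import FunctionalExtensionality PropExtensionality.
Require Import Defs.
Import ListNotations.

(** Say that a relation D(x, y) is immune to an oracle Z if every total relation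
    R(x, y) that is enumerable in Z meets D.  If the two limit sets of a stable
    coloring c are hyperimmune relative to H (take for D(x, y) "at most x
    elements of the limit set lie below y"), then H is not an infinite
    homogeneous set.  A coloring whose rows are chosen generically is hyperimmune
    in this sense relative to itself, and the ideal is obtained by iterating the
    fact that any tournament has an infinite transitive subtournament that
    preserves immunity.  The latter is proved by Mathias forcing with conditions
    (F, X): to deal with a relation R, ask whether some x is such that for some
    2-coloring P of the reservoir no monochromatic transitive finite set E forces
    a y with R(x, y).  If so, a basis theorem gives such a P that preserves
    immunity and the reservoir is thinned to one color of P, making R partial.
    If not, compactness bounds the values y in terms of x by a relation
    enumerable in the reservoir; immunity provides an x with a good bound, and
    the 2-coloring by limit behaviour in T provides a suitable E.

    Nothing here depends on effectivity beyond continuity and countability, so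
    "enumerable in Z" is taken with respect to a countable family of open
    operators that is closed under the operations needed. *)

(** * Soundness *)

Lemma teval_tsubst e s t :
  teval e (tsubst s t) = teval (fun k => teval e (s k)) t.
Proof. induction t; cbn; congruence. Qed.

Lemma sat_nsubst I p : forall e E s,
  sat I e E (nsubst s p) <-> sat I (fun k => teval e (s k)) E p.
Proof.
  assert (lift : forall n e s,
    (fun k => teval (scons n e)
                (scons (Var 0) (fun k => tshift (s k)) k))
    = scons n (fun k => teval e (s k))).
  { intros n e s; extensionality k; destruct k; cbn; [reflexivity|].
    unfold tshift; rewrite teval_tsubst; reflexivity. }
  induction p; intros e E s0; cbn; rewrite ?teval_tsubst;
    try rewrite IHp1, IHp2; try tauto.
  - split; intros H n; specialize (H n); rewrite IHp, lift in *; exact H.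
  - split; intros [n H]; exists n; rewrite IHp, lift in *; exact H.
  - split; intros H X hX; specialize (H X hX); rewrite IHp in *; exact H.
  - split; intros (X & hX & H); exists X; rewrite IHp in *; auto.
Qed.

Lemma sat_srename I p : forall e E r,
  sat I e E (srename r p) <-> sat I e (fun k => E (r k)) p.
Proof.
  assert (lift : forall X (E : nat -> nat -> Prop) r,
    (fun k => scons X E (scons 0 (fun k => S (r k)) k))
    = scons X (fun k => E (r k))).
  { intros X E r; extensionality k; destruct k; reflexivity. }
  induction p; intros e E r; cbn; try rewrite IHp1, IHp2; try tauto.
  - split; intros H n; specialize (H n); rewrite IHp in *; exact H.
  - split; intros [n H]; exists n; rewrite IHp in *; exact H.
  - split; intros H X hX; specialize (H X hX); rewrite IHp, lift in *; exact H.
  - split; intros (X & hX & H); exists X; rewrite IHp, lift in *; auto.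
Qed.

Lemma sat_ninst I e E t p :
  sat I e E (ninst t p) <-> sat I (scons (teval e t) e) E p.
Proof.
  unfold ninst; rewrite sat_nsubst.
  replace (fun k => teval e (scons t Var k)) with (scons (teval e t) e);
    [tauto|extensionality k; destruct k; reflexivity].
Qed.

Lemma sat_nshift I e E n p : sat I (scons n e) E (nshift p) <-> sat I e E p.
Proof. unfold nshift; rewrite sat_nsubst; tauto. Qed.

Lemma sat_sinst I e E X p :
  sat I e E (sinst X p) <-> sat I e (scons (E X) E) p.
Proof.
  unfold sinst; rewrite sat_srename.
  replace (fun k => E (scons X (fun k => k) k)) with (scons (E X) E);
    [tauto|extensionality k; destruct k; reflexivity].
Qed.

Lemma sat_sshift I e E X p : sat I e (scons X E) (sshift p) <-> sat I e E p.
Proof. unfold sshift; rewrite sat_srename; tauto. Qed.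

(** [omega_models] quantifies over all assignments, so the eigenvariable rules may extend [e] or [E]
    while the axioms stay valid; only the open hypotheses have to be shifted. *)
Lemma proves_sound I T G p :
  proves T G p -> (forall q, T q -> omega_models I q) ->
  forall e E, (forall k, I (E k)) -> (forall q, In q G -> sat I e E q) ->
  sat I e E p.
Proof.
  intros H hT.
  assert (consI : forall X E, I X -> (forall k, I (E k)) ->
    forall k, I (scons X E k)) by (intros X E hX hE [|k]; cbn; auto).
  assert (consG : forall e E q G, sat I e E q ->
    (forall q, In q G -> sat I e E q) ->
    forall r, In r (q :: G) -> sat I e E r)
    by (intros e E q G0 h1 h2 r [<-|hr]; auto).
  assert (mapN : forall e E n G, (forall q, In q G -> sat I e E q) ->
    forall q, In q (map nshift G) -> sat I (scons n e) E q).
  { intros e E n G0 h q hq; apply in_map_iff in hq.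
    destruct hq as (r & <- & hr); apply sat_nshift; auto. }
  assert (mapS : forall e E X G, (forall q, In q G -> sat I e E q) ->
    forall q, In q (map sshift G) -> sat I e (scons X E) q).
  { intros e E X G0 h q hq; apply in_map_iff in hq.
    destruct hq as (r & <- & hr); apply sat_sshift; auto. }
  induction H; intros e E hE hG.
  - apply (hT p H e E hE).
  - auto.
  - apply NNPP; intros h; apply (IHproves e E hE); apply consG; [exact h|exact hG].
  - intros h; apply (IHproves e E hE); apply consG; [exact h|exact hG].
  - exact (IHproves1 e E hE hG (IHproves2 e E hE hG)).
  - split; [apply (IHproves1 e E hE hG)|apply (IHproves2 e E hE hG)].
  - apply (IHproves e E hE hG).
  - apply (IHproves e E hE hG).
  - left; apply (IHproves e E hE hG).
  - right; apply (IHproves e E hE hG).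
  - destruct (IHproves1 e E hE hG) as [h|h];
      [apply (IHproves2 e E hE)|apply (IHproves3 e E hE)];
      (apply consG; [exact h|exact hG]).
  - intros n; exact (IHproves _ E hE (mapN _ _ _ _ hG)).
  - apply sat_ninst; apply (IHproves e E hE hG).
  - exists (teval e t); apply sat_ninst; apply (IHproves e E hE hG).
  - destruct (IHproves1 e E hE hG) as [n hn].
    apply (sat_nshift I e E n); apply (IHproves2 _ E hE).
    exact (consG _ _ _ _ hn (mapN _ _ _ _ hG)).
  - intros X hX; exact (IHproves e _ (consI _ _ hX hE) (mapS _ _ _ _ hG)).
  - apply sat_sinst; apply (IHproves e E hE hG); auto.
  - exists (E X); split; [auto|]; apply sat_sinst; apply (IHproves e E hE hG).
  - destruct (IHproves1 e E hE hG) as (X & hX & h).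
    apply (sat_sshift I e E X); apply (IHproves2 e _ (consI _ _ hX hE)).
    exact (consG _ _ _ _ h (mapS _ _ _ _ hG)).
  - reflexivity.
  - apply sat_ninst; cbn in IHproves1; rewrite <- (IHproves1 e E hE hG).
    apply sat_ninst; apply (IHproves2 e E hE hG).
Qed.

(** * Open operators *)

Notation oracle := (nat -> Prop) (only parsing).

Definition evens (X : oracle) : oracle := fun n => X (2 * n).
Definition odds (X : oracle) : oracle := fun n => X (2 * n + 1).
Definition compl (X : oracle) : oracle := fun n => ~ X n.
Definition chi (X : oracle) : oracle := turing_join X (compl X).

Lemma oracle_ext (X Y : oracle) : (forall n, X n <-> Y n) -> X = Y.
Proof.
  intros h; extensionality n; apply propositional_extensionality; apply h.
Qed.

Lemma evens_join X Y : evens (turing_join X Y) = X.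
Proof.
  apply oracle_ext; intros n; unfold evens, turing_join; split.
  - intros (k & [[h hX]|[h _]]); [|lia].
    replace n with k by lia; exact hX.
  - intros h; exists n; auto.
Qed.

Lemma odds_join X Y : odds (turing_join X Y) = Y.
Proof.
  apply oracle_ext; intros n; unfold odds, turing_join; split.
  - intros (k & [[h _]|[h hY]]); [lia|].
    replace n with k by lia; exact hY.
  - intros h; exists n; auto.
Qed.

Lemma join_even X Y n : turing_join X Y (2 * n) <-> X n.
Proof. change (evens (turing_join X Y) n <-> X n); rewrite evens_join; tauto. Qed.

Lemma join_odd X Y n : turing_join X Y (2 * n + 1) <-> Y n.
Proof. change (odds (turing_join X Y) n <-> Y n); rewrite odds_join; tauto. Qed.

Lemma compl_join X Y :
  compl (turing_join X Y) = turing_join (compl X) (compl Y).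
Proof.
  apply oracle_ext; intros n; unfold compl at 1.
  destruct (Nat.Even_or_Odd n) as [[k ->]|[k ->]];
    rewrite ?join_even, ?join_odd; unfold compl; tauto.
Qed.

Lemma compl_compl X : compl (compl X) = X.
Proof. apply oracle_ext; intros n; unfold compl; split; [apply NNPP|tauto]. Qed.

Definition agree (n : nat) (X Y : oracle) : Prop :=
  forall i, i < n -> (X i <-> Y i).

Lemma agree_le m n X Y : m <= n -> agree n X Y -> agree m X Y.
Proof. intros h H i hi; apply H; lia. Qed.

Lemma agree_refl n X : agree n X X.
Proof. intros i _; tauto. Qed.

Lemma agree_trans n X Y Z : agree n X Y -> agree n Y Z -> agree n X Z.
Proof. intros h h' i hi; specialize (h i hi); specialize (h' i hi); tauto. Qed.

Lemma agree_join n X Y X' Y' :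
  agree n X X' -> agree n Y Y' -> agree n (turing_join X Y) (turing_join X' Y').
Proof.
  intros h1 h2 i hi; destruct (Nat.Even_or_Odd i) as [[k ->]|[k ->]];
    rewrite ?join_even, ?join_odd; [apply h1|apply h2]; lia.
Qed.

Lemma agree_evens n X Y : agree (2 * n) X Y -> agree n (evens X) (evens Y).
Proof. intros h i hi; apply h; lia. Qed.

Lemma agree_odds n X Y : agree (2 * n) X Y -> agree n (odds X) (odds Y).
Proof. intros h i hi; apply h; lia. Qed.

Lemma bounded_max (n : nat) (Q : nat -> nat -> Prop) :
  (forall i m m', m <= m' -> Q i m -> Q i m') ->
  (forall i, i < n -> exists m, Q i m) ->
  exists m, forall i, i < n -> Q i m.
Proof.
  intros mono; induction n as [|n IH]; intros h; [exists 0; lia|].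
  destruct IH as [m hm]; [intros; apply h; lia|].
  destruct (h n) as [m' hm']; [lia|].
  exists (max m m'); intros i hi.
  destruct (Nat.eq_dec i n) as [->|ne].
  - apply (mono n m'); [lia|exact hm'].
  - apply (mono i m); [lia|apply hm; lia].
Qed.

(** Topological stand-in for enumerability: each fact in the output is secured by a finite initial
    segment of the oracle. Both positive and negative information may be used, so nothing is
    monotone in [Z]. *)
Definition open (U : oracle -> oracle) : Prop :=
  forall Z x, U Z x -> exists n, forall Z', agree n Z Z' -> U Z' x.

Lemma open_meet2 (P Q : oracle -> Prop) Z :
  (exists n, forall Z', agree n Z Z' -> P Z') ->
  (exists n, forall Z', agree n Z Z' -> Q Z') ->
  exists n, forall Z', agree n Z Z' -> P Z' /\ Q Z'.
Proof.
  intros [m hm] [n hn]; exists (max m n); intros Z' h; split;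
    [apply hm|apply hn]; apply (agree_le _ (max m n)); auto; lia.
Qed.

Lemma open_join U V :
  open U -> open V -> open (fun Z => turing_join (U Z) (V Z)).
Proof.
  intros hU hV Z x; destruct (Nat.Even_or_Odd x) as [[k ->]|[k ->]]; intros h.
  - apply join_even in h; destruct (hU Z k h) as [n hn].
    exists n; intros; apply join_even; auto.
  - apply join_odd in h; destruct (hV Z k h) as [n hn].
    exists n; intros; apply join_odd; auto.
Qed.

Lemma open_and U V :
  open U -> open V -> open (fun Z n => U Z n /\ V Z n).
Proof. intros hU hV Z x [h1 h2]; apply open_meet2; auto. Qed.

Lemma open_or U V :
  open U -> open V -> open (fun Z n => U Z n \/ V Z n).
Proof.
  intros hU hV Z x [h|h]; [destruct (hU Z x h) as [n hn]|
    destruct (hV Z x h) as [n hn]]; exists n; auto.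
Qed.

Lemma open_evens U : open U -> open (fun Z => evens (U Z)).
Proof. intros hU Z x h; apply (hU Z (2 * x) h). Qed.

Lemma open_odds U : open U -> open (fun Z => odds (U Z)).
Proof. intros hU Z x h; apply (hU Z (2 * x + 1) h). Qed.

Lemma open_chi (u : nat -> nat) : open (fun Z => chi (fun n => Z (u n))).
Proof.
  apply open_join; intros Z x h; exists (S (u x)); intros Z' hZ';
    specialize (hZ' (u x) (Nat.lt_succ_diag_r _)); unfold compl in *; tauto.
Qed.

Lemma open_const (X : oracle) : open (fun _ => X).
Proof. intros Z x h; exists 0; auto. Qed.

(** * Oracle computations: use principle and determinism *)

Lemma cpair_inj x y x' y' : cpair x y = cpair x' y' -> x = x' /\ y = y'.
Proof.
  unfold cpair; intros h; apply Cantor.to_nat_inj in h; injection h; auto.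
Qed.

(** A halting computation asks finitely many oracle questions; for [Cmin] the finitely many
    subcomputations are bounded together. The dummy argument [n = 0] only gives the statement the
    shape of [open]. *)
Lemma eval_open c x y : open (fun Z n => n = 0 /\ eval Z c x y).
Proof.
  intros Z n [-> h].
  enough (exists n, forall Z', agree n Z Z' -> eval Z' c x y) as [n hn]
    by (exists n; auto).
  induction h as [| | | |x hx|x hx|f g x y z _ IH1 _ IH2|f g x y z _ IH1 _ IH2
    |f g a y _ IH|f g a n y z _ IH1 _ IH2|f a m v _ IH1 _ [k IH2]];
    try (exists 0; intros; constructor; fail).
  - exists (S x); intros Z' h; apply eval_oracle1, h; auto.
  - exists (S x); intros Z' h; apply eval_oracle0; rewrite <- (h x); auto.
  - destruct (open_meet2 _ _ _ IH1 IH2) as [n hn]; exists n; intros Z' h.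
    constructor; apply hn; auto.
  - destruct (open_meet2 _ _ _ IH1 IH2) as [n hn]; exists n; intros Z' h.
    econstructor; apply hn; auto.
  - destruct IH as [n hn]; exists n; intros; constructor; auto.
  - destruct (open_meet2 _ _ _ IH1 IH2) as [k hk]; exists k; intros Z' h.
    econstructor; apply hk; auto.
  - destruct (bounded_max m (fun k n => forall Z', agree n Z Z' ->
      eval Z' f (cpair a k) (S (v k)))) as [n hn].
    + intros i p q hpq h Z' hZ'; apply h; apply (agree_le p q); auto.
    + intros i hi; apply IH1; auto.
    + exists (max n k); intros Z' h; apply eval_min with v.
      * intros i hi; apply hn; auto; apply (agree_le n (max n k)); auto; lia.
      * apply IH2; apply (agree_le k (max n k)); auto; lia.
Qed.

Lemma eval_det Z c x y : eval Z c x y -> forall y', eval Z c x y' -> y = y'.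
Proof.
  induction 1 as [| | | |x hx|x hx|f g x y z _ IH1 _ IH2|f g x y z _ IH1 _ IH2
    |f g a y _ IH|f g a n y z _ IH1 _ IH2|f a m v h1 IH1 h2 IH2];
    intros y' h';
    (* Abstracting the input makes inversion leave equations between pair codes, which [cpair_inj]
       then resolves. *)
    match type of h' with eval _ _ ?w _ => remember w as u eqn:hu end;
    inversion h'; subst;
    repeat match goal with
    | H : cpair _ _ = cpair _ _ |- _ =>
        apply cpair_inj in H; destruct H; subst
    end; try reflexivity; try tauto; try discriminate.
  - f_equal; auto.
  - rewrite <- (IH1 _ H1) in H4; auto.
  - auto.
  - match goal with H : S _ = S _ |- _ => injection H as <- end.
    rewrite <- (IH1 _ H1) in H4; auto.
  - destruct (Nat.lt_trichotomy m y') as [h|[h|h]]; auto.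
    + specialize (IH2 _ (H0 m h)); discriminate.
    + match goal with H : eval _ _ _ 0 |- _ =>
        specialize (IH1 y' h _ H); discriminate end.
Qed.

Definition fst_of (z : nat) : nat := fst (Cantor.of_nat z).
Definition snd_of (z : nat) : nat := snd (Cantor.of_nat z).

Lemma fst_of_cpair x y : fst_of (cpair x y) = x.
Proof. unfold fst_of, cpair; rewrite Cantor.cancel_of_to; reflexivity. Qed.

Lemma snd_of_cpair x y : snd_of (cpair x y) = y.
Proof. unfold snd_of, cpair; rewrite Cantor.cancel_of_to; reflexivity. Qed.

Definition trans_on (T S : oracle) : Prop :=
  forall x y z, S x -> S y -> S z ->
    T (npair x y) -> T (npair y z) -> T (npair x z).

(** Right-nested joins [X0 + (X1 + (X2 + ...))] store finitely many set parameters in one oracle. *)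
Definition column (k : nat) (Z : oracle) : oracle := evens (Nat.iter k odds Z).

(** Names for the operators.  Apart from countability, only openness and closure
    under the operations used in the proofs matter, so most constructors are
    interpreted by noncomputable means.  A set [X] counts as computed from [Z]
    when an operator sends [Z] to [chi X], that is, enumerates both [X] and its
    complement.  [PFan] and [PEM] serve the compactness argument and the forcing
    question, with oracle [((Z + T) + X) + P] in the latter case. *)
Inductive prog : Type :=
| PSelf | PEvens | POdds
| PSection (a : nat) | PAbove (n : nat)
| PNot (p : prog) | PAnd (p q : prog) | PJoin (p q : prog)
| PCode (c : code)
| PSigma (q : form) (l : list nat)
| PMerge (p q : prog)
| PSubst (v q : prog)
| PFan (r : prog)
| POr (q : prog) (x : nat) (r : prog)
| PEx (r : prog)
| PCount
| PEM (F : list nat) (r : prog).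

(** The clauses are shaped to be open. [PSigma] asks for truth on a whole neighbourhood of [Z],
    which for a [Delta00] matrix amounts to truth at [Z]. [PSubst] runs [q] on finite strings
    confirmed by the enumeration [v]. In [POr] the fixed input [x] expresses that the oracle has
    left a closed class. In [PEM] one number bounds both the set [E] and the value [y]. *)
Fixpoint den (p : prog) (Z : oracle) : oracle :=
  match p with
  | PSelf => chi Z
  | PEvens => chi (evens Z)
  | POdds => chi (odds Z)
  | PSection a => chi (fun y => Z (npair a y))
  | PAbove n => chi (fun y => n < y)
  | PNot p => turing_join (odds (den p Z)) (evens (den p Z))
  | PAnd p q =>
      turing_join (fun i => evens (den p Z) i /\ evens (den q Z) i)
                  (fun i => odds (den p Z) i \/ odds (den q Z) i)
  | PJoin p q =>
      turing_join (turing_join (evens (den p Z)) (evens (den q Z)))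
                  (turing_join (odds (den p Z)) (odds (den q Z)))
  | PCode c => turing_join (fun i => eval Z c i 1) (fun i => eval Z c i 0)
  | PSigma q l => fun n => exists k b, forall Z', agree b Z Z' ->
      sat (fun _ => True) (scons k (scons n (fun i => nth i l 0)))
          (fun X => column X Z') q
  | PMerge p q => turing_join (den p Z) (den q Z)
  | PSubst v q => fun x => exists n Y,
      (forall i, i < n ->
         (Y i -> evens (den v Z) i) /\ (~ Y i -> odds (den v Z) i)) /\
      (forall Y', agree n Y Y' -> den q Y' x)
  | PFan r => fun z => forall P, exists y, y <= snd_of z /\
      den r (turing_join Z P) (cpair (fst_of z) y)
  | POr q x r => fun z => den q Z x \/ den r Z z
  | PEx r => fun x => exists y, den r Z (cpair x y)
  | PCount => fun z => exists l, NoDup l /\ fst_of z < length l /\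
      forall a, In a l -> a < snd_of z /\ Z a
  | PEM F r => fun z =>
      let ZT := evens (evens Z) in
      exists E, (forall a, In a E -> a < snd_of z /\ odds (evens Z) a) /\
        ((forall a, In a E -> odds Z a) \/ (forall a, In a E -> ~ odds Z a)) /\
        trans_on (odds ZT) (fun a => In a E) /\
        exists y, y <= snd_of z /\
          den r (turing_join ZT (fun a => In a F \/ In a E))
                (cpair (fst_of z) y)
  end.

(** * Dependent choice, compactness and openness of the operators *)

Lemma dependent_choice {A : Type} (Inv : A -> Prop)
    (Step : nat -> A -> A -> Prop) (a0 : A) :
  Inv a0 ->
  (forall n a, Inv a -> exists a', Inv a' /\ Step n a a') ->
  exists f : nat -> A, f 0 = a0 /\
    forall n, Inv (f n) /\ Step n (f n) (f (S n)).
Proof.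
  intros h0 hs.
  assert (h : forall n (s : {a | Inv a}),
    {s' : {a | Inv a} | Step n (proj1_sig s) (proj1_sig s')}).
  { intros n [a ha]; apply constructive_indefinite_description.
    destruct (hs n a ha) as (a' & ha' & st); exists (exist _ a' ha'); exact st. }
  pose (g := fix g n : {a | Inv a} :=
    match n with 0 => exist _ a0 h0 | S n => proj1_sig (h n (g n)) end).
  exists (fun n => proj1_sig (g n)); split; [reflexivity|]; intros n; split.
  - exact (proj2_sig (g n)).
  - exact (proj2_sig (h n (g n))).
Qed.

(** Compactness of Cantor space. A string is bad if no bound works on its cylinder; a bad string has
    a bad one-bit extension, and a path through bad strings contradicts the hypothesis. The number
    [n] is both the bounded quantity and the modulus of continuity. *)
Lemma fan (U : nat -> oracle -> Prop) :
  (forall P, exists n, forall P', agree n P P' -> U n P') ->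
  exists N, forall P, exists n, n <= N /\ U n P.
Proof.
  intros hU; apply NNPP; intros hN.
  pose (bad := fun k P0 => forall N, exists P,
    agree k P0 P /\ forall n, n <= N -> ~ U n P).
  destruct (dependent_choice (fun s => bad (fst s) (snd s))
    (fun _ s s' => fst s' = S (fst s) /\ agree (fst s) (snd s) (snd s'))
    (0, fun _ => False)) as (f & f0 & hf).
  - intros N; apply NNPP; intros h; apply hN; exists N; intros P.
    apply NNPP; intros h'; apply h; exists P; split.
    + intros i hi; cbn in hi; lia.
    + intros n hn hu; apply h'; exists n; auto.
  - intros _ [k P0] hb; cbn in *.
    pose (P1 := fun i => i < k /\ P0 i \/ i = k).
    pose (P2 := fun i => i < k /\ P0 i).
    destruct (classic (bad (S k) P1)) as [h1|h1];
      [exists (S k, P1); cbn; split; [exact h1|split; [reflexivity|]];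
       intros i hi; unfold P1; intuition lia|].
    destruct (classic (bad (S k) P2)) as [h2|h2];
      [exists (S k, P2); cbn; split; [exact h2|split; [reflexivity|]];
       intros i hi; unfold P2; intuition lia|].
    exfalso.
    apply not_all_ex_not in h1; destruct h1 as [N1 h1].
    apply not_all_ex_not in h2; destruct h2 as [N2 h2].
    (* This [P] defeats both bounds, so its bit at [k] tells which of the two extensions is bad
       after all. *)
    destruct (hb (max N1 N2)) as (P & ag & hP).
    destruct (classic (P k)) as [hk|hk]; [apply h1|apply h2]; exists P; split;
      try (intros n hn; apply hP; lia);
      intros i hi; unfold P1, P2;
      (destruct (Nat.eq_dec i k) as [->|ne];
       [intuition lia|rewrite (ag i) by lia; intuition lia]).
  - assert (hk : forall n, fst (f n) = n).
    { induction n as [|n IH]; [rewrite f0; reflexivity|].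
      destruct (hf n) as [_ [-> _]]; congruence. }
    assert (ha : forall m n, m <= n -> agree m (snd (f m)) (snd (f n))).
    { intros m n h; induction h as [|n h IH]; [apply agree_refl|].
      apply agree_trans with (snd (f n)); [exact IH|].
      destruct (hf n) as [_ [_ hag]]; rewrite hk in hag.
      apply (agree_le m n); assumption. }
    pose (P := fun i => snd (f (S i)) i).
    destruct (hU P) as [n hn].
    destruct (hf n) as [hb _]; rewrite hk in hb.
    destruct (hb n) as (Q & ag & hQ).
    apply (hQ n (le_n n)); apply hn.
    apply agree_trans with (snd (f n)); [|exact ag].
    intros i hi; apply (ha (S i) n); lia.
Qed.

Lemma den_open p : open (den p).
Proof.
  induction p; cbn [den].
  - exact (open_chi (fun n => n)).
  - exact (open_chi (fun n => 2 * n)).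
  - exact (open_chi (fun n => 2 * n + 1)).
  - exact (open_chi (fun y => npair a y)).
  - apply open_const.
  - apply open_join; [apply open_odds|apply open_evens]; exact IHp.
  - apply open_join; [apply open_and|apply open_or];
      (apply open_evens + apply open_odds); assumption.
  - repeat apply open_join; (apply open_evens + apply open_odds); assumption.
  - apply open_join; intros Z x h;
      (destruct (eval_open c x _ Z 0 (conj eq_refl h)) as [n hn];
       exists n; intros; apply hn; assumption).
  - intros Z n (k & b & h); exists b; intros Z' h'; exists k, b; intros Z'' h''.
    apply h; apply agree_trans with Z'; assumption.
  - apply open_join; assumption.
  - intros Z x (n & Y & h & hq).
    destruct (bounded_max n (fun i m => forall Z', agree m Z Z' ->
      (Y i -> evens (den p1 Z') i) /\ (~ Y i -> odds (den p1 Z') i)))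
      as [m hm].
    + intros i m m' le h' Z' ag; apply h'; apply (agree_le m m'); assumption.
    + intros i hi; destruct (h i hi) as [h1 h2].
      destruct (classic (Y i)) as [hY|hY].
      * destruct (IHp1 Z _ (h1 hY)) as [m hm]; exists m; intros Z' ag.
        split; [intros _; exact (hm Z' ag)|tauto].
      * destruct (IHp1 Z _ (h2 hY)) as [m hm]; exists m; intros Z' ag.
        split; [tauto|intros _; exact (hm Z' ag)].
    + exists m; intros Z' ag; exists n, Y; auto.
  - intros Z z h.
    (* Compactness in [P] yields one modulus in [Z] that serves all [P] at once. *)
    destruct (fan (fun n P => forall Z', agree n Z Z' ->
      exists y, y <= snd_of z /\
        den p (turing_join Z' P) (cpair (fst_of z) y))) as [N hN].
    + intros P; destruct (h P) as (y & hy & hd).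
      destruct (IHp _ _ hd) as [n hn]; exists n.
      intros P' aP Z' aZ; exists y; split; [exact hy|].
      apply hn, agree_join; assumption.
    + exists N; intros Z' ag P; destruct (hN P) as (n & le & hn).
      apply hn; apply (agree_le n N); assumption.
  - intros Z z [h|h]; [destruct (IHp1 _ _ h) as [n hn]|
      destruct (IHp2 _ _ h) as [n hn]]; exists n; intros; auto.
  - intros Z z [y h]; destruct (IHp _ _ h) as [n hn]; exists n.
    intros; exists y; auto.
  - intros Z z (l & nd & hl & h); exists (snd_of z); intros Z' ag.
    exists l; split; [exact nd|split; [exact hl|]]; intros a ha.
    destruct (h a ha) as [lt hZ]; split; [exact lt|apply ag; assumption].
  - intros Z z (E & hE & hP & hT & y & hy & hr).
    destruct (IHp _ _ hr) as [n hn].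
    (* All pairs from [E] have codes below [m], so the transitivity of [E] reads only a finite part
       of the tournament. *)
    destruct (bounded_max (snd_of z) (fun x m => forall y, y < snd_of z ->
      npair x y < m)) as [m hm].
    { intros x m m' le h w hw; specialize (h w hw); lia. }
    { intros x hx.
      destruct (bounded_max (snd_of z) (fun w m => npair x w < m)) as [m hm].
      - intros; lia.
      - intros w hw; exists (S (npair x w)); lia.
      - exists m; exact hm. }
    set (b := max n (max m (snd_of z))).
    (* The tournament sits three joins deep in the oracle, and each projection halves the known
       segment. *)
    exists (2 * (2 * (2 * b))); intros Z' ag.
    assert (a1 : agree (2 * (2 * b)) (evens Z) (evens Z'))
      by (apply agree_evens; exact ag).
    assert (a2 : agree (2 * b) (evens (evens Z)) (evens (evens Z')))
      by (apply agree_evens; exact a1).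
    assert (a3 : agree b (odds (evens (evens Z))) (odds (evens (evens Z'))))
      by (apply agree_odds; exact a2).
    assert (a4 : agree (2 * b) (odds (evens Z)) (odds (evens Z')))
      by (apply agree_odds; exact a1).
    assert (a5 : agree (2 * (2 * b)) (odds Z) (odds Z'))
      by (apply agree_odds; exact ag).
    exists E; split; [|split; [|split]].
    + intros a ha; destruct (hE a ha) as [lt hX]; split; [exact lt|].
      apply a4; [lia|exact hX].
    + destruct hP as [hP|hP]; [left|right]; intros a ha;
        destruct (hE a ha) as [lt _]; rewrite <- (a5 a) by lia; auto.
    + intros u v w hu hv hw.
      destruct (hE u hu) as [lu _], (hE v hv) as [lv _], (hE w hw) as [lw _].
      pose proof (hm u lu v lv); pose proof (hm v lv w lw);
        pose proof (hm u lu w lw).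
      intros h1 h2; apply a3; [lia|].
      apply (hT u v w); try assumption; apply a3; assumption || lia.
    + exists y; split; [exact hy|]; apply hn, agree_join.
      * apply (agree_le n (2 * b)); [lia|exact a2].
      * apply agree_refl.
Qed.

(** * Numbering of programs and requirements *)

Fixpoint enc_code (c : code) : nat :=
  match c with
  | Czero => cpair 0 0
  | Csucc => cpair 1 0
  | Cfst => cpair 2 0
  | Csnd => cpair 3 0
  | Coracle => cpair 4 0
  | Cpair f g => cpair 5 (cpair (enc_code f) (enc_code g))
  | Ccomp f g => cpair 6 (cpair (enc_code f) (enc_code g))
  | Cprec f g => cpair 7 (cpair (enc_code f) (enc_code g))
  | Cmin f => cpair 8 (enc_code f)
  end.

Fixpoint enc_term (t : term) : nat :=
  match t with
  | Var k => cpair 0 k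
  | Zero => cpair 1 0
  | One => cpair 2 0
  | Plus s t => cpair 3 (cpair (enc_term s) (enc_term t))
  | Mult s t => cpair 4 (cpair (enc_term s) (enc_term t))
  end.

Fixpoint enc_form (p : form) : nat :=
  match p with
  | Eq s t => cpair 0 (cpair (enc_term s) (enc_term t))
  | Lt s t => cpair 1 (cpair (enc_term s) (enc_term t))
  | Mem t X => cpair 2 (cpair (enc_term t) X)
  | Bot => cpair 3 0
  | Imp p q => cpair 4 (cpair (enc_form p) (enc_form q))
  | And p q => cpair 5 (cpair (enc_form p) (enc_form q))
  | Or p q => cpair 6 (cpair (enc_form p) (enc_form q))
  | AllN p => cpair 7 (enc_form p)
  | ExN p => cpair 8 (enc_form p)
  | Defs.AllS p => cpair 9 (enc_form p)
  | ExS p => cpair 10 (enc_form p)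
  end.

Fixpoint enc_list (l : list nat) : nat :=
  match l with [] => 0 | a :: l => S (cpair a (enc_list l)) end.

Fixpoint enc_prog (p : prog) : nat :=
  match p with
  | PSelf => cpair 0 0
  | PEvens => cpair 1 0
  | POdds => cpair 2 0
  | PSection a => cpair 3 a
  | PAbove n => cpair 4 n
  | PNot p => cpair 5 (enc_prog p)
  | PAnd p q => cpair 6 (cpair (enc_prog p) (enc_prog q))
  | PJoin p q => cpair 7 (cpair (enc_prog p) (enc_prog q))
  | PCode c => cpair 8 (enc_code c)
  | PSigma q l => cpair 9 (cpair (enc_form q) (enc_list l))
  | PMerge p q => cpair 10 (cpair (enc_prog p) (enc_prog q))
  | PSubst v q => cpair 11 (cpair (enc_prog v) (enc_prog q))
  | PFan r => cpair 12 (enc_prog r)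
  | POr q x r => cpair 13 (cpair (enc_prog q) (cpair x (enc_prog r)))
  | PEx r => cpair 14 (enc_prog r)
  | PCount => cpair 15 0
  | PEM F r => cpair 16 (cpair (enc_list F) (enc_prog r))
  end.

Ltac split_cpair :=
  repeat match goal with
  | H : S _ = S _ |- _ => injection H; clear H; intro H
  | H : cpair _ _ = cpair _ _ |- _ => apply cpair_inj in H; destruct H
  end.

Lemma enc_code_inj c c' : enc_code c = enc_code c' -> c = c'.
Proof.
  revert c'; induction c; intros []; cbn [enc_code]; intros H; split_cpair;
    try discriminate; f_equal; auto.
Qed.

Lemma enc_term_inj t t' : enc_term t = enc_term t' -> t = t'.
Proof.
  revert t'; induction t; intros []; cbn [enc_term]; intros H; split_cpair;
    try discriminate; f_equal; auto.
Qed.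

Lemma enc_form_inj p p' : enc_form p = enc_form p' -> p = p'.
Proof.
  revert p'; induction p; intros []; cbn [enc_form]; intros H; split_cpair;
    try discriminate; f_equal; auto using enc_term_inj.
Qed.

Lemma enc_list_inj l l' : enc_list l = enc_list l' -> l = l'.
Proof.
  revert l'; induction l; intros []; cbn [enc_list]; intros H;
    try discriminate; split_cpair; f_equal; auto.
Qed.

Lemma enc_prog_inj p p' : enc_prog p = enc_prog p' -> p = p'.
Proof.
  revert p'; induction p; intros []; cbn [enc_prog]; intros H; split_cpair;
    try discriminate;
    f_equal; auto using enc_code_inj, enc_form_inj, enc_list_inj.
Qed.

(** Each construction treats immunity of color [i] against the relation enumerated by [r] at the
    stage with this number. *)
Definition enc_req (i : bool) (r : prog) : nat :=
  cpair (if i then 1 else 0) (enc_prog r).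

Lemma enc_req_inj i r i' r' :
  enc_req i r = enc_req i' r' -> i = i' /\ r = r'.
Proof.
  unfold enc_req; intros H; split_cpair; split; [|apply enc_prog_inj; assumption].
  destruct i, i'; congruence.
Qed.

(** * Reducibility and immunity *)

Definition red_by (p : prog) (X Z : oracle) : Prop := den p Z = chi X.
Definition red (X Z : oracle) : Prop := exists p, red_by p X Z.

(** When [v] enumerates exactly [X] and its complement, the only confirmed strings are initial
    segments of [X], and openness of [q] makes these sufficient. *)
Lemma subst_den v X Z q : red_by v X Z -> den (PSubst v q) Z = den q X.
Proof.
  unfold red_by; intros hv; cbn [den]; rewrite hv.
  unfold chi; rewrite evens_join, odds_join.
  apply oracle_ext; intros x; split.
  - intros (n & Y & h & hq); apply hq; intros i hi.
    destruct (h i hi) as [h1 h2]; unfold compl in h2; tauto.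
  - intros h; destruct (den_open q X x h) as [n hn].
    exists n, X; split; [unfold compl; tauto|exact hn].
Qed.

Lemma red_trans X Y Z : red X Y -> red Y Z -> red X Z.
Proof.
  intros [p hp] [v hv]; exists (PSubst v p).
  unfold red_by; rewrite (subst_den v Y Z p hv); exact hp.
Qed.

Lemma red_refl X : red X X.
Proof. exists PSelf; reflexivity. Qed.

Lemma red_evens X : red (evens X) X.
Proof. exists PEvens; reflexivity. Qed.

Lemma red_odds X : red (odds X) X.
Proof. exists POdds; reflexivity. Qed.

Lemma red_joinl X Y : red X (turing_join X Y).
Proof. rewrite <- (evens_join X Y) at 1; apply red_evens. Qed.

Lemma red_joinr X Y : red Y (turing_join X Y).
Proof. rewrite <- (odds_join X Y) at 1; apply red_odds. Qed.

Lemma red_section T a : red (fun y => T (npair a y)) T.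
Proof. exists (PSection a); reflexivity. Qed.

Lemma red_above n Z : red (fun y => n < y) Z.
Proof. exists (PAbove n); reflexivity. Qed.

Lemma red_compl X Z : red X Z -> red (compl X) Z.
Proof.
  intros [p hp]; exists (PNot p); unfold red_by in *; cbn [den]; rewrite hp.
  unfold chi; rewrite odds_join, evens_join, compl_compl; reflexivity.
Qed.

Lemma red_and X Y Z : red X Z -> red Y Z -> red (fun n => X n /\ Y n) Z.
Proof.
  intros [p hp] [q hq]; exists (PAnd p q); unfold red_by in *; cbn [den].
  rewrite hp, hq; unfold chi; rewrite !odds_join, !evens_join; f_equal.
  apply oracle_ext; intros n; unfold compl; tauto.
Qed.

Lemma red_join X Y Z : red X Z -> red Y Z -> red (turing_join X Y) Z.
Proof.
  intros [p hp] [q hq]; exists (PJoin p q); unfold red_by in *; cbn [den].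
  rewrite hp, hq; unfold chi; rewrite !odds_join, !evens_join, compl_join.
  reflexivity.
Qed.

(** Determinism keeps the outputs [1] and [0] apart, so [PCode] enumerates exactly [X] and its
    complement. Closure under [red] therefore entails closure under Turing reducibility. *)
Lemma red_turing X Y : turing_le X Y -> red X Y.
Proof.
  intros [c hc]; exists (PCode c); unfold red_by, chi; cbn [den].
  f_equal; apply oracle_ext; intros n; destruct (hc n) as [h1 h0];
    (split; [|assumption]).
  - intros h; apply NNPP; intros hn.
    discriminate (eval_det _ _ _ _ h _ (h0 hn)).
  - intros h hX; discriminate (eval_det _ _ _ _ h _ (h1 hX)).
Qed.

(** [D] is thought of as the relation [y <= f x] of a function [f], and
    [immune D Z] then says that no [Z]-computable function dominates [f]. *)
Definition immune (D : nat -> nat -> Prop) (Z : oracle) : Prop :=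
  forall q, (forall x, exists y, den q Z (cpair x y)) ->
  exists x y, den q Z (cpair x y) /\ D x y.

Definition down_closed (D : nat -> nat -> Prop) : Prop :=
  forall x y y', y <= y' -> D x y' -> D x y.

Lemma immune_red D X Z : red X Z -> immune D Z -> immune D X.
Proof.
  intros [v hv] h q; rewrite <- (subst_den v X Z q hv); apply h.
Qed.

(** If [r] is total relative to every [P], compactness makes [PFan r] total relative to [Z] alone,
    and immunity of [Z] applied to it supplies one good bound for all [P]. *)
Lemma immune_dichotomy D Z r :
  immune D Z ->
  (exists x P, forall y, ~ den r (turing_join Z P) (cpair x y)) \/
  (exists x b, D x b /\
     forall P, exists y, y <= b /\ den r (turing_join Z P) (cpair x y)).
Proof.
  intros hZ.
  destruct (classic (exists x P,
    forall y, ~ den r (turing_join Z P) (cpair x y))) as [h|h]; [left; exact h|].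
  right; destruct (hZ (PFan r)) as (x & b & hd & hD).
  - intros x.
    destruct (fan (fun n P => exists y, y <= n /\
      den r (turing_join Z P) (cpair x y))) as [N hN].
    + intros P.
      assert (exists y, den r (turing_join Z P) (cpair x y)) as [y hy].
      { apply NNPP; intros h'; apply h; exists x, P; intros y hy; apply h'.
        exists y; exact hy. }
      destruct (den_open r _ _ hy) as [n hn].
      (* The maximum bounds the value and is a modulus, since [fan] uses one number for both. *)
      exists (max n y); intros P' ag; exists y; split; [lia|].
      apply hn, agree_join; [apply agree_refl|].
      apply (agree_le n (max n y)); [lia|exact ag].
    + exists N; cbn [den]; rewrite fst_of_cpair, snd_of_cpair; intros P.
      destruct (hN P) as (n & hn & y & hy & hd); exists y; split; [lia|exact hd].
  - cbn [den] in hd; rewrite fst_of_cpair, snd_of_cpair in hd.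
    exists x, b; auto.
Qed.

(** An analogue of the hyperimmune-free basis theorem. *)
Lemma immune_basis (D : bool -> nat -> nat -> Prop) Z q x :
  (forall i, down_closed (D i)) -> (forall i, immune (D i) Z) ->
  (exists P, ~ den q (turing_join Z P) x) ->
  exists P, ~ den q (turing_join Z P) x /\
    forall i, immune (D i) (turing_join Z P).
Proof.
  intros hD hZ hq.
  (* A pair names the closed class of those [P] for which a given number is never enumerated; the
     construction shrinks such classes. *)
  pose (K := fun (s : prog * nat) P => ~ den (fst s) (turing_join Z P) (snd s)).
  destruct (dependent_choice (fun s => exists P, K s P)
    (fun n s s' => (forall P, K s' P -> K s P) /\
      forall i r, enc_req i r = n -> forall P, K s' P ->
        (forall x, exists y, den r (turing_join Z P) (cpair x y)) ->
        exists x y, den r (turing_join Z P) (cpair x y) /\ D i x y)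
    (q, x)) as (f & f0 & hf).
  - exact hq.
  - intros n [q' x'] hs.
    destruct (classic (exists i r, enc_req i r = n)) as [(i & r & <-)|hn].
    (* With [POr], every [P] outside the current class counts as answered, so the dichotomy speaks
       about the class only. *)
    + destruct (immune_dichotomy (D i) Z (POr q' x' r) (hZ i))
        as [(x1 & P1 & h1)|(x1 & b & hb & h1)].
      (* Shrink to those [P] in the class for which [r] has no value at [x1]; this is again a class
         of the same form, and [P1] belongs to it. *)
      * exists (PEx (POr q' x' r), x1); split.
        { exists P1; unfold K; cbn [den fst snd]; intros [y h]; exact (h1 y h). }
        unfold K; cbn [fst snd]; split.
        { intros P h1' h; apply h1'; exists 0; left; exact h. }
        intros i' r' e P hP tot.
        apply enc_req_inj in e; destruct e as [-> ->].
        destruct (tot x1) as [y hy]; exfalso; apply hP; exists y; right; exact hy.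
      * exists (q', x'); split; [exact hs|split; [auto|]].
        intros i' r' e P hP _.
        apply enc_req_inj in e; destruct e as [-> ->].
        destruct (h1 P) as (y & hy & [h|h]); [destruct (hP h)|].
        exists x1, y; split; [exact h|apply (hD i x1 y b); assumption].
    + exists (q', x'); split; [exact hs|split; [auto|]].
      intros i r e; exfalso; apply hn; exists i, r; exact e.
  - assert (mono : forall m n P, m <= n -> K (f n) P -> K (f m) P).
    { intros m n P h; induction h as [|n h IH]; auto.
      intros h'; apply IH; destruct (hf n) as [_ [hK _]]; auto. }
    (* By compactness the decreasing nonempty closed classes have a common member. *)
    assert (exists P, forall n, K (f n) P) as [P hP].
    { apply NNPP; intros hno.
      destruct (fan (fun n P => ~ K (f n) P)) as [N hN].
      - intros P; apply NNPP; intros hno'; apply hno; exists P; intros n hn.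
        destruct (den_open _ _ _ hn) as [m hm].
        apply hno'; exists (max m n); intros P' ag hK.
        apply (mono n) in hK; [|lia]; apply hK, hm, agree_join.
        + apply agree_refl.
        + apply (agree_le m (max m n)); [lia|exact ag].
      - destruct (hf N) as [[P hP] _]; destruct (hN P) as (n & le & hn).
        apply hn, (mono n N); assumption. }
    exists P; split; [specialize (hP 0); rewrite f0 in hP; exact hP|].
    intros i r tot; destruct (hf (enc_req i r)) as [_ [_ h]].
    apply (h i r eq_refl P (hP _) tot).
Qed.

(** * Transitive subtournaments *)

Definition infinite (S : oracle) : Prop := forall m, exists n, m < n /\ S n.

Definition tournament (T : oracle) : Prop :=
  (forall x, ~ T (npair x x)) /\
  (forall x y, x <> y ->
     (T (npair x y) /\ ~ T (npair y x)) \/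
     (~ T (npair x y) /\ T (npair y x))).

Lemma infinite_split X Y :
  infinite X -> infinite (fun n => X n /\ Y n) \/ infinite (fun n => X n /\ ~ Y n).
Proof.
  intros h; apply NNPP; intros hn; apply not_or_and in hn; destruct hn as [h1 h2].
  apply not_all_ex_not in h1; destruct h1 as [m1 h1].
  apply not_all_ex_not in h2; destruct h2 as [m2 h2].
  destruct (h (max m1 m2)) as (n & hn & hX).
  destruct (classic (Y n)); [apply h1|apply h2]; exists n;
    (split; [lia|split; assumption]).
Qed.

Lemma bounded_list (S : oracle) n :
  exists l, forall a, In a l <-> a < n /\ S a.
Proof.
  induction n as [|n [l IH]]; [exists []; cbn; intuition lia|].
  destruct (classic (S n)) as [h|h].
  - exists (n :: l); intros a; cbn; rewrite IH.
    split; [intros [<-|[]]; auto|].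
    intros [lt hS]; destruct (Nat.eq_dec n a); [auto|right; split; [lia|auto]].
  - exists l; intros a; rewrite IH; split; [intuition lia|].
    intros [lt hS]; split; [|exact hS].
    destruct (Nat.eq_dec a n) as [->|]; [tauto|lia].
Qed.

(** Finite replacement for cohesiveness: every [a < b] has constant behaviour
    towards [Y]. *)
Lemma homogeneous_thinning T W X b :
  red T W -> red X W -> infinite X ->
  exists Y P, infinite Y /\ red Y W /\ (forall y, Y y -> X y /\ b <= y) /\
    forall a y, a < b -> Y y -> (T (npair a y) <-> P a).
Proof.
  intros hT hX inf; induction b as [|b (Y & P & hi & hr & hs & hP)].
  - exists X, (fun _ => True); repeat split; auto; lia.
  - pose (C := fun y => T (npair b y)).
    assert (hC : red C W) by exact (red_trans _ _ _ (red_section T b) hT).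
    assert (exists Y', infinite Y' /\ red Y' W /\ (forall y, Y' y -> Y y) /\
      exists i : Prop, forall y, Y' y -> (C y <-> i))
      as (Y' & hi' & hr' & hs' & i & hC').
    { destruct (infinite_split Y C hi) as [h|h].
      - exists (fun n => Y n /\ C n); split; [exact h|split].
        + apply red_and; assumption.
        + split; [tauto|exists True; tauto].
      - exists (fun n => Y n /\ compl C n); split; [exact h|split].
        + apply red_and; [|apply red_compl]; assumption.
        + split; [tauto|exists False; unfold compl; tauto]. }
    exists (fun y => Y' y /\ b < y), (fun a => (a < b /\ P a) \/ (a = b /\ i)).
    split; [|split; [|split]].
    + intros m; destruct (hi' (max m b)) as (n & lt & hn); exists n.
      split; [lia|split; [exact hn|lia]].
    + apply red_and; [exact hr'|apply red_above].
    + intros y [hy lt]; split; [apply hs; auto|lia].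
    + intros a y lt [hy _]; destruct (Nat.eq_dec a b) as [->|ne].
      * pose proof (hC' y hy) as h; unfold C in h; intuition lia.
      * rewrite (hP a y) by (auto; lia); intuition lia.
Qed.

(** The truth value [i] is the common direction of all arrows between the two sets. In a mixed
    triple either the required arrow has this direction, or one of the two given arrows violates
    it. *)
Lemma trans_union T E E2 (i : Prop) :
  tournament T ->
  (forall a y, E a -> E2 y -> a <> y /\ (T (npair a y) <-> i)) ->
  trans_on T E -> trans_on T E2 -> trans_on T (fun a => E a \/ E2 a).
Proof.
  intros [irr tot] hi h1 h2 x y z hx hy hz hxy hyz.
  assert (flip : forall a y, E a -> E2 y -> (T (npair y a) <-> ~ i)).
  { intros a w ha hw; destruct (hi a w ha hw) as [ne h].
    destruct (tot a w ne); tauto. }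
  destruct hx as [hx|hx], hy as [hy|hy], hz as [hz|hz].
  - exact (h1 x y z hx hy hz hxy hyz).
  - apply (hi x z hx hz), (hi y z hy hz), hyz.
  - apply (flip z y hz hy) in hyz; apply (hi x y hx hy) in hxy; tauto.
  - apply (hi x z hx hz), (hi x y hx hy), hxy.
  - apply (flip z x hz hx), (flip y x hy hx), hxy.
  - apply (flip y x hy hx) in hxy; apply (hi y z hy hz) in hyz; tauto.
  - apply (flip z x hz hx), (flip z y hz hy), hyz.
  - exact (h2 x y z hx hy hz hxy hyz).
Qed.

(** * Mathias forcing with tournament conditions *)

Section Mathias.

Variables (D : bool -> nat -> nat -> Prop) (T Z : oracle).
Hypotheses (hD : forall i, down_closed (D i)) (hT : tournament T).

Let ZT : oracle := turing_join Z T.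
Let elems (F : list nat) : oracle := fun a => In a F.

(** The last clause plays the role of the usual requirement that the reservoir
    lies in a minimal interval of the finite part. *)
Definition mcond (s : list nat * oracle) : Prop :=
  infinite (snd s) /\ (forall i, immune (D i) (turing_join ZT (snd s))) /\
  forall E : oracle, (forall a, E a -> snd s a) -> trans_on T E ->
    trans_on T (fun a => elems (fst s) a \/ E a).

Definition mext (s' s : list nat * oracle) : Prop :=
  (forall a, In a (fst s) -> In a (fst s')) /\
  (forall a, In a (fst s') -> In a (fst s) \/ snd s a) /\
  (forall a, snd s' a -> snd s a).

Definition msat (s : list nat * oracle) (G : oracle) : Prop :=
  trans_on T G /\ (forall a, In a (fst s) -> G a) /\
  (forall a, G a -> In a (fst s) \/ snd s a).

Lemma trans_sub (S S' : oracle) :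
  (forall a, S a -> S' a) -> trans_on T S' -> trans_on T S.
Proof. intros h H x y z hx hy hz; apply H; auto. Qed.

Lemma mext_refl s : mext s s.
Proof. repeat split; auto. Qed.

Lemma mext_trans s s' s'' : mext s'' s' -> mext s' s -> mext s'' s.
Proof.
  intros (a1 & a2 & a3) (b1 & b2 & b3); repeat split; auto.
  intros a h; destruct (a2 a h) as [h'|h']; auto.
Qed.

(** All arrows between [E] and [Y] have one direction, so [E] joined with a transitive subset of [Y]
    is a transitive subset of [X], to which the last clause for [(F, X)] applies. Immunity survives
    because [Y] is computed from the old data. *)
Lemma mcond_extend F X E n (P Y : oracle) :
  mcond (F, X) -> (forall a, In a E -> X a) -> trans_on T (elems E) ->
  infinite Y -> red Y (turing_join ZT X) ->
  (forall y, Y y -> X y /\ n <= y) -> (forall a, In a E -> a < n) ->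
  (forall a y, a < n -> Y y -> (T (npair a y) <-> P a)) ->
  ((forall a, In a E -> P a) \/ (forall a, In a E -> ~ P a)) ->
  mcond (F ++ E, Y) /\ mext (F ++ E, Y) (F, X).
Proof.
  intros (inf & im & key) hE tE infY rY hY hn hP hom; split; [split; [|split]|].
  - exact infY.
  - intros i; apply (immune_red _ _ (turing_join ZT X)); [|apply im].
    apply red_join; [apply red_joinl|exact rY].
  - cbn; intros E2 hE2 tE2.
    assert (h : trans_on T (fun a => elems E a \/ E2 a)).
    { assert (exists i : Prop, forall a, In a E -> (P a <-> i)) as [i hi].
      { destruct hom as [hom|hom]; [exists True|exists False]; intros a ha;
          specialize (hom a ha); tauto. }
      apply (trans_union T (elems E) E2 i hT); [|exact tE|exact tE2].
      intros a y ha hy; pose proof (hn a ha); destruct (hY y (hE2 y hy)).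
      split; [lia|]; rewrite (hP a y) by auto; exact (hi a ha). }
    assert (sub : forall a, elems E a \/ E2 a -> X a)
      by (intros a [ha|ha]; [exact (hE a ha)|apply hY, hE2, ha]).
    generalize (key _ sub h); apply trans_sub; cbn; unfold elems; intros a; rewrite in_app_iff.
    tauto.
  - repeat split; cbn; intros a; rewrite ?in_app_iff; [auto| |apply hY].
    intros [h|h]; auto.
Qed.

(** A single point of the reservoir is transitive and has one color, so it may be added once the
    reservoir is thinned to behave uniformly towards it. *)
Lemma mcond_grow s n :
  mcond s -> exists s', mcond s' /\ mext s' s /\ exists a, n < a /\ In a (fst s').
Proof.
  destruct s as [F X]; intros hs; pose proof hs as (inf & im & key).
  destruct (inf n) as (a & lt & ha); cbn in ha.
  destruct (homogeneous_thinning T (turing_join ZT X) X (S a))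
    as (Y & P & infY & rY & hY & hP).
  - apply (red_trans _ ZT); [apply red_joinr|apply red_joinl].
  - apply red_joinr.
  - exact inf.
  - destruct (mcond_extend F X [a] (S a) P Y hs) as [h1 h2]; auto.
    + intros b [<-|[]]; exact ha.
    + intros x y z [<-|[]] [<-|[]] [<-|[]] h _; exact h.
    + intros b [<-|[]]; lia.
    + destruct (classic (P a)); [left|right]; intros b [<-|[]]; assumption.
    + exists (F ++ [a], Y); split; [exact h1|split; [exact h2|]].
      exists a; split; [exact lt|]; cbn; rewrite in_app_iff; cbn; auto.
Qed.

(** Quantifying over every compatible [G] makes the requirement persist under all later
    extensions. *)
Definition forced (s : list nat * oracle) (i : bool) (r : prog) : Prop :=
  forall G, msat s G ->
    (forall x, exists y, den r (turing_join ZT G) (cpair x y)) ->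
    exists x y, den r (turing_join ZT G) (cpair x y) /\ D i x y.

Lemma mcond_force s i r :
  mcond s -> exists s', mcond s' /\ mext s' s /\ forced s' i r.
Proof.
  destruct s as [F X]; intros hs; pose proof hs as (inf & im & key).
  cbn in inf, im, key.
  set (W := turing_join ZT X) in *.
  destruct (immune_dichotomy (D i) W (PEM F r) (im i))
    as [(x & P0 & h0)|(x & b & hb & h)].
  (* The coloring [P0] may destroy immunity; the basis theorem replaces it by one with the same
     property at [x] that preserves immunity. *)
  - destruct (immune_basis D W (PEx (PEM F r)) x hD im) as (P & hP & imP).
    { exists P0; intros [y hy]; exact (h0 y hy). }
    assert (exists X', infinite X' /\ red X' (turing_join W P) /\
      (forall a, X' a -> X a) /\
      ((forall a, X' a -> P a) \/ (forall a, X' a -> ~ P a)))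
      as (X' & inf' & red' & sub & hom).
    { assert (red X (turing_join W P))
        by (apply (red_trans _ W); [apply red_joinr|apply red_joinl]).
      destruct (infinite_split X P inf) as [h|h];
        [exists (fun n => X n /\ P n)|exists (fun n => X n /\ compl P n)];
        (split; [exact h|split; [|split]]).
      - apply red_and; [assumption|apply red_joinr].
      - tauto.
      - left; tauto.
      - apply red_and; [assumption|apply red_compl, red_joinr].
      - tauto.
      - right; unfold compl; tauto. }
    exists (F, X'); split; [split; [exact inf'|split]|split].
    + intros j; apply (immune_red _ _ (turing_join W P)); [|apply imP].
      apply red_join; [|exact red'].
      apply (red_trans _ W); apply red_joinl.
    + cbn; intros E hE; apply key; auto.
    + repeat split; cbn; auto.
    (* A value of [r] at [x] uses only finitely much of [G]. The part of [G] in [X'] below this use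
       is transitive and of one color for [P], hence a set [E] of the kind excluded by the choice of
       [P]. *)
    + intros G (tG & hF & hG) tot; exfalso; apply hP.
      destruct (tot x) as [y hy]; destruct (den_open r _ _ hy) as [n hn].
      destruct (bounded_list (fun a => G a /\ X' a) n) as [E hE].
      exists (max n y); cbn [den].
      rewrite fst_of_cpair, snd_of_cpair, odds_join, evens_join.
      unfold W; rewrite evens_join, odds_join.
      change (odds ZT) with (odds (turing_join Z T)); rewrite odds_join.
      exists E; split; [|split; [|split]].
      * intros a ha; apply hE in ha; split; [lia|apply sub; tauto].
      * destruct hom as [hom|hom]; [left|right]; intros a ha; apply hE in ha;
          apply hom; tauto.
      * revert tG; apply trans_sub; intros a ha; apply hE in ha; tauto.
      * exists y; split; [lia|]; apply hn, agree_join; [apply agree_refl|].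
        intros a lt; rewrite hE; split.
        -- intros ha; destruct (hG a ha) as [h|h]; [left; exact h|].
           right; cbn in h; auto.
        -- intros [h|h]; [apply hF; exact h|tauto].
  - destruct (homogeneous_thinning T W X b)
      as (Y & P & infY & rY & hY & hPY).
    + apply (red_trans _ ZT); [apply red_joinr|apply red_joinl].
    + apply red_joinr.
    + exact inf.
    (* The bound [b] holds for every coloring, in particular for the limit behaviour [P] towards
       [Y]. The resulting [E] lies below [b], where [P] describes the arrows to [Y]. *)
    + destruct (h P) as (y & hyb & hd); cbn [den] in hd.
      rewrite fst_of_cpair, snd_of_cpair, odds_join, evens_join in hd.
      unfold W in hd; rewrite evens_join, odds_join in hd.
      change (odds ZT) with (odds (turing_join Z T)) in hd.
      rewrite odds_join in hd.
      destruct hd as (E & hE & hom & tE & y0 & hy0 & hr).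
      destruct (den_open r _ _ hr) as [n hn].
      (* Removing numbers up to the use [n] ensures that every compatible [G] agrees with [F ++ E]
         below [n], which preserves the computation. *)
      destruct (mcond_extend F X E b P (fun y => Y y /\ n < y) hs)
        as [h1 h2]; auto.
      * intros a ha; apply hE; exact ha.
      * intros m; destruct (infY (max m n)) as (a & lt & ha).
        exists a; split; [lia|split; [exact ha|lia]].
      * apply red_and; [exact rY|apply red_above].
      * intros a [ha _]; auto.
      * intros a ha; destruct (hE a ha); lia.
      * intros a w lt [hw _]; auto.
      * exists (F ++ E, fun y => Y y /\ n < y).
        split; [exact h1|split; [exact h2|]].
        intros G (tG & hF & hG) _; cbn in hF, hG.
        exists x, y0; split; [|apply (hD i x y0 b); [lia|exact hb]].
        apply hn, agree_join; [apply agree_refl|].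
        intros a lt; rewrite <- in_app_iff; split; [apply hF|].
        intros ha; destruct (hG a ha) as [h'|[_ h']]; [exact h'|lia].
Qed.

Lemma immune_transitive :
  (forall i, immune (D i) ZT) ->
  exists G, infinite G /\ trans_on T G /\
    forall i, immune (D i) (turing_join ZT G).
Proof.
  intros hZ.
  destruct (dependent_choice mcond
    (fun n s s' => mext s' s /\ (exists a, n < a /\ In a (fst s')) /\
       forall i r, enc_req i r = n -> forced s' i r)
    (* The positive numbers form an infinite initial reservoir that [red_above] computes. *)
    ([], fun y => 0 < y)) as (f & _ & hf).
  - split; [|split].
    + intros m; exists (S m); cbn; split; lia.
    + intros i; apply (immune_red _ _ ZT); [|apply hZ].
      apply red_join; [apply red_refl|apply red_above].
    + cbn; intros E _; apply trans_sub; intros a [[]|h]; exact h.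
  - intros n s hs; destruct (mcond_grow s n hs) as (s1 & h1 & e1 & a & lt & ha).
    destruct (classic (exists i r, enc_req i r = n)) as [(i & r & <-)|hn].
    + destruct (mcond_force s1 i r h1) as (s2 & h2 & e2 & hfo).
      exists s2; split; [exact h2|split; [|split]].
      * apply (mext_trans s s1 s2); assumption.
      * exists a; split; [exact lt|apply e2; exact ha].
      * intros i' r' e; apply enc_req_inj in e; destruct e as [-> ->]; exact hfo.
    + exists s1; split; [exact h1|split; [exact e1|split; [exists a; auto|]]].
      intros i r e; exfalso; apply hn; exists i, r; exact e.
  - assert (ext : forall m n, m <= n -> mext (f n) (f m)).
    { intros m n h; induction h as [|n h IH]; [apply mext_refl|].
      apply (mext_trans _ (f n)); [apply hf|exact IH]. }
    pose (G := fun a => exists n, In a (fst (f n))).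
    assert (sat : forall n, msat (f n) G).
    { intros n; split; [|split].
      - intros x y z [n1 h1] [n2 h2] [n3 h3].
        set (N := max n1 (max n2 n3)).
        destruct (hf N) as [(_ & _ & key) _].
        (* The empty set in the last clause of [mcond] yields transitivity of the finite part. *)
        apply (key (fun _ => False)); [tauto|intros ? ? ? []|..]; left;
          [apply (ext n1 N)|apply (ext n2 N)|apply (ext n3 N)];
          assumption || lia.
      - intros a h; exists n; exact h.
      - intros a [m h]; destruct (Nat.le_ge_cases m n) as [le|le].
        + left; apply (ext m n le); exact h.
        + apply (ext n m le); exact h. }
    exists G; split; [|split].
    + intros m; destruct (hf m) as [_ (_ & (a & lt & ha) & _)].
      exists a; split; [exact lt|exists (S m); exact ha].
    + apply (sat 0).
    + intros i r tot; destruct (hf (enc_req i r)) as [_ (_ & _ & h)].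
      exact (h i r eq_refl G (sat _) tot).
Qed.

End Mathias.

(** * A generic stable coloring *)

Definition coloring : Type := nat -> nat -> bool.

Definition graph (c : coloring) : oracle := fun z =>
  exists x y, x < y /\ z = npair (npair x y) (if c x y then 1 else 0).

Definition row_limit (c : coloring) (a : nat) (i : bool) : Prop :=
  exists m, forall y, m < y -> c a y = i.

(** [immune (sparse c i)] says that the limit set of color [i] is hyperimmune. *)
Definition sparse (c : coloring) (i : bool) (x y : nat) : Prop :=
  forall l, NoDup l -> (forall a, In a l -> a < y /\ row_limit c a i) ->
  length l <= x.

Lemma sparse_down_closed c i : down_closed (sparse c i).
Proof.
  intros x y y' le h l nd hl; apply h; [exact nd|].
  intros a ha; destruct (hl a ha); split; [lia|assumption].
Qed.

(** A condition [(k, c)] fixes the rows [c a] for [a < k]. *)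
Definition in_cond (s : nat * coloring) (c : coloring) : Prop :=
  forall x y, x < fst s -> x < y -> c x y = snd s x y.

Lemma graph_agree (c c' : coloring) n :
  (forall x y, x < y -> y < n -> c x y = c' x y) -> agree n (graph c) (graph c').
Proof.
  enough (h : forall c c' : coloring,
    (forall x y, x < y -> y < n -> c x y = c' x y) ->
    forall z, z < n -> graph c z -> graph c' z).
  { intros e z lt; split; apply h; auto; intros; symmetry; auto. }
  intros d d' e z lt (x & y & hxy & ->); exists x, y; split; [exact hxy|].
  rewrite e; [reflexivity|exact hxy|]; unfold npair in lt; nia.
Qed.

(** With [k] rows fixed, ask whether some compatible coloring gives [r] a value [y] at input [k]. If
    so, keep the part of it that is used and let all further rows up to beyond [y] have limit
    [negb i]; then only the first [k] rows can contribute elements of limit color [i] below [y]. If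
    not, [r] is already partial at [k]. *)
Lemma generic_coloring :
  exists c : coloring, (forall a, exists i, row_limit c a i) /\
    forall i, immune (sparse c i) (graph c).
Proof.
  destruct (dependent_choice
    (fun s => forall a, a < fst s -> exists i, row_limit (snd s) a i)
    (fun n s s' => fst s < fst s' /\
      (forall x y, x < fst s -> snd s' x y = snd s x y) /\
      forall i r, enc_req i r = n -> forall c, in_cond s' c ->
        (forall x, exists y, den r (graph c) (cpair x y)) ->
        exists x y, den r (graph c) (cpair x y) /\ sparse c i x y)
    (0, fun _ _ => false)) as (f & _ & hf).
  - cbn; lia.
  - intros n [k c0] hs; cbn in hs.
    assert (row : forall x y, x < k ->
      (if x <? k then c0 x y else false) = c0 x y).
    { intros x y h; apply Nat.ltb_lt in h; rewrite h; reflexivity. }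
    destruct (classic (exists i r c y, enc_req i r = n /\ in_cond (k, c0) c /\
      den r (graph c) (cpair k y))) as [(i & r & c & y & <- & hc & hr)|hno].
    + destruct (den_open r _ _ hr) as [n hn].
      (* Exceeds the old rows, the use of the computation and the value [y]. *)
      set (k' := S (max k (max n y))).
      set (c1 := fun x z => if x <? k then c0 x z
                            else if z <? k' then c x z else negb i).
      assert (c1_old : forall x z, x < k -> c1 x z = c0 x z).
      { intros x z h; unfold c1; apply Nat.ltb_lt in h; rewrite h; reflexivity. }
      assert (c1_new : forall x z, k <= x -> k' <= z -> c1 x z = negb i).
      { intros x z h h'; unfold c1.
        apply Nat.ltb_ge in h, h'; rewrite h, h'; reflexivity. }
      assert (c1_mid : forall x z, x < z -> z < k' -> c1 x z = c x z).
      { intros x z h h'; unfold c1.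
        destruct (x <? k) eqn:e; [apply Nat.ltb_lt in e; symmetry; apply hc; auto|].
        apply Nat.ltb_lt in h'; rewrite h'; reflexivity. }
      exists (k', c1); cbn [fst snd]; split; [|split; [lia|split; [exact c1_old|]]].
      * intros a _; destruct (Nat.lt_ge_cases a k) as [h|h].
        -- destruct (hs a h) as (j & m & hm); exists j, m; intros z hz.
           rewrite c1_old; auto.
        -- exists (negb i), k'; intros z hz; apply c1_new; lia.
      * intros i' r' e c' hc' _; apply enc_req_inj in e; destruct e as [-> ->].
        unfold in_cond in hc'; cbn in hc'.
        exists k, y; split.
        -- apply hn, graph_agree; intros x z h h'.
           rewrite hc', c1_mid; auto; lia.
        -- intros l nd hl; rewrite <- (length_seq k 0).
           apply NoDup_incl_length; [exact nd|]; intros a ha; apply in_seq.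
           destruct (hl a ha) as (lt & m & hm).
           destruct (Nat.lt_ge_cases a k) as [h|h]; [lia|exfalso].
           (* A column past the supposed limit stage [m], past [k'] and to the right of [a]. *)
           specialize (hm (k' + m + a) ltac:(lia)).
           rewrite hc', c1_new in hm by lia; destruct i; discriminate.
    + exists (S k, fun x y => if x <? k then c0 x y else false).
      cbn [fst snd]; split; [|split; [lia|split; [exact row|]]].
      * intros a _; destruct (Nat.lt_ge_cases a k) as [h|h].
        -- destruct (hs a h) as (j & m & hm); exists j, m; intros z hz.
           rewrite row; auto.
        -- exists false, 0; intros z _; apply Nat.ltb_ge in h; rewrite h.
           reflexivity.
      * intros i r e c hc tot; exfalso; apply hno.
        destruct (tot k) as [y hy]; exists i, r, c, y.
        split; [exact e|split; [|exact hy]].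
        intros x z h hz; unfold in_cond in hc; cbn in *; rewrite hc, row; auto.
  - assert (hk : forall n, n <= fst (f n)).
    { induction n; [lia|]; destruct (hf n) as [_ [h _]]; lia. }
    assert (ext : forall m n, m <= n -> fst (f m) <= fst (f n) /\
      forall x y, x < fst (f m) -> snd (f n) x y = snd (f m) x y).
    { intros m n h; induction h as [|n h [IH1 IH2]]; [auto|].
      destruct (hf n) as [_ (h1 & h2 & _)]; split; [lia|].
      intros x y hx; rewrite h2 by lia; auto. }
    (* At stage [S x] more than [x] rows are fixed, so row [x] is final there. *)
    set (c := fun x y => snd (f (S x)) x y).
    assert (hc : forall n, in_cond (f n) c).
    { intros n x y hx _; unfold c; pose proof (hk (S x)).
      destruct (Nat.le_ge_cases n (S x)) as [le|le].
      - apply (ext n (S x) le); exact hx.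
      - symmetry; apply (ext (S x) n le); lia. }
    exists c; split.
    + intros a; destruct (hf (S a)) as [h _].
      destruct (h a (hk (S a))) as (i & m & hm); exists i, m; exact hm.
    + intros i r tot; destruct (hf (enc_req i r)) as [_ (_ & _ & h)].
      exact (h i r eq_refl c (hc _) tot).
Qed.

(** * Recursive comprehension *)

Lemma teval_fin t : exists B, forall e e' : nat -> nat,
  (forall k, k < B -> e k = e' k) -> teval e t = teval e' t.
Proof.
  induction t as [k| | |s [a ha] t [b hb]|s [a ha] t [b hb]]; cbn.
  - exists (S k); auto.
  - exists 0; auto.
  - exists 0; auto.
  - exists (max a b); intros e e' h; rewrite (ha e e'), (hb e e');
      [reflexivity|intros; apply h; lia..].
  - exists (max a b); intros e e' h; rewrite (ha e e'), (hb e e');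
      [reflexivity|intros; apply h; lia..].
Qed.

Definition depends_below (B : nat) (p : form) : Prop :=
  forall I e e' E E', (forall k, k < B -> e k = e' k) ->
    (forall k, k < B -> E k = E' k) -> (sat I e E p <-> sat I e' E' p).

(** Finitely many parameters occur, so those of number sort fit into the list of [PSigma] and those
    of set sort into the columns of one oracle. *)
Lemma sat_fin p : exists B, depends_below B p.
Proof.
  unfold depends_below.
  assert (up : forall (A : Type) B (a : A) (s s' : nat -> A),
    (forall k, k < B -> s k = s' k) ->
    forall k, k < B -> scons a s k = scons a s' k).
  { intros A B a s s' h [|k] lt; cbn; [reflexivity|apply h; lia]. }
  induction p as [s t|s t|t X| |p [a ha] q [b hb]|p [a ha] q [b hb]
    |p [a ha] q [b hb]|p [a ha]|p [a ha]|p [a ha]|p [a ha]]; cbn.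
  - destruct (teval_fin s) as [a ha], (teval_fin t) as [b hb].
    exists (max a b); intros I e e' E E' h _.
    rewrite (ha e e'), (hb e e'); [tauto|intros; apply h; lia..].
  - destruct (teval_fin s) as [a ha], (teval_fin t) as [b hb].
    exists (max a b); intros I e e' E E' h _.
    rewrite (ha e e'), (hb e e'); [tauto|intros; apply h; lia..].
  - destruct (teval_fin t) as [a ha].
    exists (max a (S X)); intros I e e' E E' h hE.
    rewrite (ha e e'), (hE X); [tauto|lia|intros; apply h; lia].
  - exists 0; tauto.
  - exists (max a b); intros I e e' E E' h hE.
    rewrite (ha I e e' E E'), (hb I e e' E E');
      [tauto|intros; (apply h || apply hE); lia..].
  - exists (max a b); intros I e e' E E' h hE.
    rewrite (ha I e e' E E'), (hb I e e' E E');
      [tauto|intros; (apply h || apply hE); lia..].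
  - exists (max a b); intros I e e' E E' h hE.
    rewrite (ha I e e' E E'), (hb I e e' E E');
      [tauto|intros; (apply h || apply hE); lia..].
  - exists a; intros I e e' E E' h hE; split; intros H n;
      apply (ha I (scons n e) (scons n e') E E');
      first [apply up; assumption|auto].
  - exists a; intros I e e' E E' h hE; split; intros [n H]; exists n;
      apply (ha I (scons n e) (scons n e') E E');
      first [apply up; assumption|auto].
  - exists a; intros I e e' E E' h hE; split; intros H X hX;
      apply (ha I e e' (scons X E) (scons X E'));
      first [apply up; assumption|auto].
  - exists a; intros I e e' E E' h hE; split; intros (X & hX & H); exists X;
      (split; [exact hX|]); apply (ha I e e' (scons X E) (scons X E'));
      first [apply up; assumption|auto].
Qed.

Lemma depends_below_le B B' p :
  B <= B' -> depends_below B p -> depends_below B' p.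
Proof.
  intros le h I e e' E E' he hE; apply h; intros; [apply he|apply hE]; lia.
Qed.

(** Use principle: a bounded quantifier has finitely many instances, whose bounds are combined.
    Since there are no set quantifiers, the second order part may change as well. *)
Lemma delta_use p : Delta00 p -> forall e E, exists b, forall I I' E',
  (forall X, X < b -> agree b (E X) (E' X)) -> (sat I e E p <-> sat I' e E' p).
Proof.
  assert (shift : forall n e t, teval (scons n e) (tshift t) = teval e t).
  { intros; unfold tshift; rewrite teval_tsubst; reflexivity. }
  assert (weaken : forall b b' (E E' : nat -> oracle), b <= b' ->
    (forall X, X < b' -> agree b' (E X) (E' X)) ->
    forall X, X < b -> agree b (E X) (E' X)).
  { intros b b' E E' le h X lt; apply (agree_le b b'); [exact le|apply h; lia]. }
  assert (bounded : forall p,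
    (forall e E, exists b, forall I I' E',
      (forall X, X < b -> agree b (E X) (E' X)) ->
      (sat I e E p <-> sat I' e E' p)) ->
    forall e E k, exists b, forall n, n < k -> forall I I' E',
      (forall X, X < b -> agree b (E X) (E' X)) ->
      (sat I (scons n e) E p <-> sat I' (scons n e) E' p)).
  { intros q h e E k; apply (bounded_max k (fun n b => forall I I' E',
      (forall X, X < b -> agree b (E X) (E' X)) ->
      (sat I (scons n e) E q <-> sat I' (scons n e) E' q))); [|auto].
    intros n b b' le H I I' E' ag; apply H; apply (weaken b b'); assumption. }
  induction 1 as [s t|s t|t X| |p q _ IH1 _ IH2|p q _ IH1 _ IH2|p q _ IH1 _ IH2
    |t p _ IH|t p _ IH]; intros e E; cbn [sat].
  - exists 0; tauto.
  - exists 0; tauto.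
  - exists (S (max X (teval e t))); intros I I' E' h; apply h; lia.
  - exists 0; tauto.
  - destruct (IH1 e E) as [a ha], (IH2 e E) as [b hb]; exists (max a b).
    intros I I' E' h; rewrite (ha I I' E'), (hb I I' E'); [tauto|..];
      (eapply weaken; [|exact h]; lia).
  - destruct (IH1 e E) as [a ha], (IH2 e E) as [b hb]; exists (max a b).
    intros I I' E' h; rewrite (ha I I' E'), (hb I I' E'); [tauto|..];
      (eapply weaken; [|exact h]; lia).
  - destruct (IH1 e E) as [a ha], (IH2 e E) as [b hb]; exists (max a b).
    intros I I' E' h; rewrite (ha I I' E'), (hb I I' E'); [tauto|..];
      (eapply weaken; [|exact h]; lia).
  - destruct (bounded p IH e E (teval e t)) as [b hb]; exists b.
    intros I I' E' h; split; intros H n lt;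
      pose proof lt as lt'; rewrite shift in lt';
      apply (hb n lt' I I' E' h); auto.
  - destruct (bounded p IH e E (teval e t)) as [b hb]; exists b.
    intros I I' E' h; split; intros (n & lt & H); exists n;
      (split; [exact lt|]); rewrite shift in lt;
      apply (hb n lt I I' E' h); auto.
Qed.

Lemma column_0 X Y : column 0 (turing_join X Y) = X.
Proof. apply evens_join. Qed.

Lemma column_S k X Y : column (S k) (turing_join X Y) = column k Y.
Proof. unfold column; rewrite Nat.iter_succ_r, odds_join; reflexivity. Qed.

Lemma agree_column k n : exists b, forall Z Z',
  agree b Z Z' -> agree n (column k Z) (column k Z').
Proof.
  induction k as [|k [b hb]].
  - exists (2 * n); intros; apply agree_evens; assumption.
  - exists (2 * b); intros Z Z' h; unfold column; rewrite !Nat.iter_succ_r.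
    apply hb, agree_odds, h.
Qed.

(** By [delta_use], a true instance of the matrix at [J] remains true on a neighbourhood of [J], as
    [PSigma] demands. *)
Lemma sigma_den I q l J e E B n :
  Delta00 q -> depends_below B q ->
  (forall i, i < B -> nth i l 0 = e i) ->
  (forall X, X < B -> column X J = E X) ->
  den (PSigma q l) J n <-> exists k, sat I (scons k (scons n e)) E q.
Proof.
  intros hd hB hl hJ.
  assert (swap : forall k,
    sat I (scons k (scons n e)) E q <->
    sat I (scons k (scons n (fun i => nth i l 0))) (fun X => column X J) q).
  { intros k; apply hB.
    - intros [|[|i]] lt; cbn; [reflexivity..|symmetry; apply hl; lia].
    - intros X lt; symmetry; apply hJ; exact lt. }
  cbn [den]; split.
  - intros (k & b & h); exists k; apply swap.
    destruct (delta_use q hd (scons k (scons n (fun i => nth i l 0)))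
      (fun X => column X J)) as [b' hb'].
    apply (hb' _ (fun _ => True) (fun X => column X J)); [intros; apply agree_refl|].
    apply h, agree_refl.
  - intros [k h]; apply swap in h.
    destruct (delta_use q hd (scons k (scons n (fun i => nth i l 0)))
      (fun X => column X J)) as [b hb].
    destruct (bounded_max b (fun X m => forall Z', agree m J Z' ->
      agree b (column X J) (column X Z'))) as [m hm].
    + intros X m m' le hm Z' ag; apply hm; apply (agree_le m m'); assumption.
    + intros X _; destruct (agree_column X b) as [m hm]; exists m; auto.
    + exists k, m; intros Z' ag; apply (hb I _ (fun X => column X Z')); auto.
Qed.

(** * The ideal generated by an increasing sequence of oracles *)

Section Ideal.

Variable G : nat -> oracle.
Hypothesis G_mono : forall m n, m <= n -> red (G m) (G n).

Definition below (X : oracle) : Prop := exists n, red X (G n).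

Lemma below_red X Y : red X Y -> below Y -> below X.
Proof. intros h [n hn]; exists n; apply (red_trans X Y); assumption. Qed.

Lemma below_join X Y : below X -> below Y -> below (turing_join X Y).
Proof.
  intros [m hm] [n hn]; exists (max m n); apply red_join.
  - apply (red_trans X (G m)); [exact hm|apply G_mono; lia].
  - apply (red_trans Y (G n)); [exact hn|apply G_mono; lia].
Qed.

Lemma below_ideal : turing_ideal below.
Proof.
  split; [exists (G 0), 0; apply red_refl|split; [|exact below_join]].
  intros X Y hY h; exact (below_red X Y (red_turing X Y h) hY).
Qed.

Lemma below_columns M : forall E, (forall X, below (E X)) ->
  exists J, below J /\ forall X, X < M -> column X J = E X.
Proof.
  induction M as [|M IH]; intros E hE; [exists (E 0); split; [auto|lia]|].
  destruct (IH (fun X => E (S X))) as (J & hJ & h); [auto|].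
  exists (turing_join (E 0) J); split; [apply below_join; auto|].
  intros [|X] lt; [apply column_0|rewrite column_S; apply h; lia].
Qed.

(** Induction holds because the numbers are standard. For comprehension, the [Sigma01] formula
    enumerates the set and the negated matrix of the [Pi01] formula enumerates its complement, from
    one oracle that joins the finitely many set parameters. *)
Lemma below_RCA0 p : RCA0 p -> omega_models below p.
Proof.
  destruct 1; intros e E hE; cbn; try lia.
  - intros [h0 hS] n; induction n as [|n IH].
    + apply sat_ninst in h0; exact h0.
    + specialize (hS n IH); unfold nsucc in hS; rewrite sat_nsubst in hS.
      replace (scons (S n) e) with (fun k => teval (scons n e)
        (scons (Plus (Var 0) One) (fun k => Var (S k)) k)); [exact hS|].
      extensionality k; destruct k; cbn; lia.
  - destruct H as (p' & dp & ->), H0 as (q' & dq & ->); intros h; cbn in h.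
    set (X := fun n => exists k, sat below (scons k (scons n e)) E p').
    exists X; split.
    + destruct (sat_fin p') as [a ha], (sat_fin q') as [b hb].
      set (B := max a b); set (l := map e (seq 0 B)).
      assert (hl : forall i, i < B -> nth i l 0 = e i).
      { intros i lt; unfold l.
        rewrite (nth_indep _ 0 (e 0)) by (rewrite length_map, length_seq; exact lt).
        rewrite map_nth, seq_nth by exact lt; reflexivity. }
      destruct (below_columns B E hE) as (J & hJ & hcol).
      apply (below_red X J); [|exact hJ].
      exists (PMerge (PSigma p' l) (PSigma (Imp q' Bot) l)).
      unfold red_by, chi; change (den (PMerge (PSigma p' l)
        (PSigma (q' ⟹ Bot) l)) J) with
        (turing_join (den (PSigma p' l) J) (den (PSigma (q' ⟹ Bot) l) J)).
      f_equal; apply oracle_ext; intros n.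
      * apply (sigma_den below p' l J e E B n dp); auto.
        apply (depends_below_le a); [lia|exact ha].
      * rewrite (sigma_den below (q' ⟹ Bot) l J e E B n); auto.
        -- destruct (h n) as [h1 h2]; unfold compl, X; cbn; split.
           ++ intros [k hk] hp; exact (hk (h1 hp k)).
           ++ intros hn; apply not_all_ex_not; auto.
        -- constructor; [exact dq|constructor].
        -- apply (depends_below_le b); [lia|].
           intros I0 e1 e2 E1 E2 h1 h2; cbn; rewrite (hb I0 e1 e2 E1 E2); tauto.
    + intros n; pose proof (sat_sshift below (scons n e) E X (ExN p')) as hs.
      assert (hX : X n <-> sat below (scons n e) E (ExN p')) by reflexivity.
      cbn in *; tauto.
Qed.

End Ideal.

(** * The ideal *)

Lemma red_iter_evens k Z : red (Nat.iter k evens Z) Z.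
Proof.
  induction k as [|k IH]; [apply red_refl|].
  apply (red_trans _ (Nat.iter k evens Z)); [apply red_evens|exact IH].
Qed.

Lemma red_by_inj p X Y Z : red_by p X Z -> red_by p Y Z -> X = Y.
Proof.
  unfold red_by; intros hX hY; rewrite hX in hY.
  rewrite <- (evens_join X (compl X)), <- (evens_join Y (compl Y)).
  unfold chi in hY; rewrite hY; reflexivity.
Qed.

(** At stage [s = cpair n (enc_prog p)] the tournament computed from [G n] by
    [p] is solved; [G n] is recovered from [G s] by iterating [evens]. *)
Lemma tower (D : bool -> nat -> nat -> Prop) G0 :
  (forall i, down_closed (D i)) -> (forall i, immune (D i) G0) ->
  exists G : nat -> oracle, G 0 = G0 /\
    (forall n i, immune (D i) (G n)) /\
    (forall m n, m <= n -> red (G m) (G n)) /\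
    forall n T, red T (G n) -> tournament T ->
      exists s S, red S (G s) /\ infinite S /\ trans_on T S.
Proof.
  intros hD h0.
  destruct (dependent_choice (fun Z => forall i, immune (D i) Z)
    (fun s Z Z' => exists H, Z' = turing_join Z H /\
      forall n p T, cpair n (enc_prog p) = s ->
        red_by p T (Nat.iter (s - n) evens Z) -> tournament T ->
        infinite H /\ trans_on T H) G0) as (G & hG0 & hG).
  - exact h0.
  - intros s Z hZ.
    destruct (classic (exists n p T, cpair n (enc_prog p) = s /\
      red_by p T (Nat.iter (s - n) evens Z) /\ tournament T))
      as [(n & p & T & <- & hp & hT)|hno].
    + assert (hTZ : red T Z)
        by (eapply red_trans; [exists p; exact hp|apply red_iter_evens]).
      destruct (immune_transitive D T Z hD hT) as (H & inf & tr & im).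
      { intros i; apply (immune_red _ _ Z); [|apply hZ].
        apply red_join; [apply red_refl|assumption]. }
      exists (turing_join Z H); split.
      * intros i; apply (immune_red _ _ _) with (2 := im i); apply red_join.
        -- apply (red_trans _ (turing_join Z T)); apply red_joinl.
        -- apply red_joinr.
      * exists H; split; [reflexivity|]; intros n' p' T' e hp' hT'.
        apply cpair_inj in e; destruct e as [-> e].
        apply enc_prog_inj in e; subst p'.
        rewrite (red_by_inj p T' T _ hp' hp); auto.
    (* An idle stage still forms a join, so that one application of [evens] always undoes one
       stage. *)
    + exists (turing_join Z Z); split.
      * intros i; apply (immune_red _ _ Z); [|apply hZ].
        apply red_join; apply red_refl.
      * exists Z; split; [reflexivity|]; intros n p T e hp hT; exfalso.
        apply hno; exists n, p, T; auto.
  - assert (mono : forall m n, m <= n -> red (G m) (G n)).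
    { intros m n h; induction h as [|n h IH]; [apply red_refl|].
      apply (red_trans _ (G n)); [exact IH|].
      destruct (hG n) as [_ (H & -> & _)]; apply red_joinl. }
    assert (back : forall k n, Nat.iter k evens (G (k + n)) = G n).
    { induction k as [|k IH]; intros n; [reflexivity|].
      rewrite Nat.iter_succ_r; cbn [Nat.add].
      destruct (hG (k + n)) as [_ (H & -> & _)]; rewrite evens_join; apply IH. }
    exists G; split; [exact hG0|split; [apply hG|split; [exact mono|]]].
    intros n T [p hp] hT; set (s := cpair n (enc_prog p)).
    destruct (hG s) as [_ (H & e & hH)].
    destruct (hH n p T eq_refl) as [inf tr]; [|exact hT|].
    (* A pair code bounds its first component, so [G n] has been built by stage [s]. *)
    + assert (n <= s).
      { unfold s, cpair.
        pose proof (Cantor.to_nat_non_decreasing n (enc_prog p)); lia. }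
      replace (G s) with (G (s - n + n)) by (f_equal; lia).
      rewrite back; exact hp.
    + exists (S s), H; split; [rewrite e; apply red_joinr|auto].
Qed.

(** Every element of such an [H] has limit color [i]. Through [PCount], [H] enumerates for each [x]
    bounds below which it has more than [x] elements; immunity yields such a bound below which the
    limit set has at most [x] elements. *)
Lemma no_homogeneous c H i :
  immune (sparse c i) H -> infinite H -> (forall a, exists j, row_limit c a j) ->
  ~ (forall x y, H x -> H y -> x < y -> c x y = i).
Proof.
  intros im inf st hom.
  assert (lim : forall a, H a -> row_limit c a i).
  { intros a ha; destruct (st a) as (j & m & hm); exists m.
    destruct (inf (max m a)) as (y & lt & hy).
    rewrite <- (hom a y ha hy), (hm y) by lia; exact hm. }
  assert (count : forall k, exists l y, NoDup l /\ length l = k /\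
    forall a, In a l -> a < y /\ H a).
  { induction k as [|k (l & y & nd & <- & hl)].
    - exists [], 0; split; [constructor|split; [reflexivity|intros a []]].
    - destruct (inf y) as (z & lt & hz); exists (z :: l), (S z); split.
      + constructor; [|exact nd]; intros h; destruct (hl z h); lia.
      + split; [reflexivity|]; intros a [<-|h]; [auto|].
        destruct (hl a h); split; [lia|assumption]. }
  destruct (im PCount) as (x & y & hd & hs).
  - intros x; destruct (count (S x)) as (l & y & nd & hl & h); exists y, l.
    rewrite fst_of_cpair, snd_of_cpair; split; [exact nd|split; [lia|exact h]].
  - destruct hd as (l & nd & hl & h).
    rewrite fst_of_cpair, snd_of_cpair in *.
    specialize (hs l nd); enough (length l <= x) by lia; apply hs.
    intros a ha; destruct (h a ha); auto.
Qed.

Theorem theorem1p15 :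
  (exists I : (nat -> Prop) -> Prop,
     turing_ideal I /\ omega_models I EM /\ ~ omega_models I SRT22) /\
  ~ proves RCA0 nil (Imp EM SRT22).
Proof.
  destruct generic_coloring as (c & st & im).
  destruct (tower (sparse c) (graph c) (sparse_down_closed c) im)
    as (G & hG0 & hG & mono & sol).
  assert (ideal : turing_ideal (below G)) by exact (below_ideal G mono).
  assert (em : omega_models (below G) EM).
  { apply omega_models_EM; [apply ideal|].
    intros T [n hT] _ irr tot.
    destruct (sol n T hT (conj irr tot)) as (s & S & hS & inf & tr).
    exists S; split; [exists s; exact hS|split; [exact inf|exact tr]]. }
  assert (nsrt : ~ omega_models (below G) SRT22).
  { intros h; rewrite omega_models_SRT22 in h by apply ideal.
    (* The generic coloring is controlled only above the diagonal, whereas the semantic form of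
       [SRT22] expects a symmetric function; the graph is unchanged. *)
    destruct (h (fun x y => c (min x y) (max x y))) as (H & [n hH] & inf & i & hom).
    - intros x y; rewrite Nat.min_comm, Nat.max_comm; reflexivity.
    - exists (G 0); split; [exists 0; apply red_refl|rewrite hG0].
      intros z; split; intros (x & y & lt & e); exists x, y;
        (split; [exact lt|]);
        rewrite Nat.min_l, Nat.max_r in * by lia; exact e.
    - intros a; destruct (st a) as (i & m & hm); exists i, (m + a).
      intros y lt; rewrite Nat.min_l, Nat.max_r by lia; apply hm; lia.
    - apply (no_homogeneous c H i); auto.
      + apply (immune_red _ _ (G n)); [exact hH|apply hG].
      + intros x y hx hy lt; rewrite <- (hom x y hx hy) by lia.
        rewrite Nat.min_l, Nat.max_r by lia; reflexivity. }
  split; [exists (below G); auto|].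
  intros pr; apply nsrt; intros e E hE.
  exact (proves_sound (below G) RCA0 [] _ pr (below_RCA0 G mono) e E hE
    (fun _ h => match h with end) (em e E hE)).
Qed.
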